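(* For every integer $n\ge 3$ and every positive integer $r$, the regular $n$-gon in a plane in $\mathbb{R}^3$ with side length $r$ (regarded as a closed polygon with $nr$ unit edges, each side subdivided into $r$ unit segments) can be domed.
   Context: A closed polygon with unit edges $\gamma=[v_1\dots v_N]$ can be domed if there is a dome over it: a finite connected 2-dimensional simplicial complex $\Sigma$ which is a compact surface whose boundary is a single cycle, with a map $f:\Sigma\to\mathbb{R}^3$ linear on each simplex, sending every triangle to an equilateral triangle of side $1$ and sending the boundary cycle of $\Sigma$ onto $\gamma$ vertex by vertex in cyclic order (no embedding/immersion required). *)

(* Defs.v *)
From mathcomp Require Import all_boot.
From Stdlib Require Import Reals.

Set Implicit Arguments.
Unset Strict Implicit.
Unset Printing Implicit Defensive.

Definition point := (R * R * R)%type.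

Definition padd (p q : point) : point :=
  let '(x1, y1, z1) := p in let '(x2, y2, z2) := q in
  ((x1 + x2)%R, (y1 + y2)%R, (z1 + z2)%R).

Definition pscale (a : R) (p : point) : point :=
  let '(x, y, z) := p in ((a * x)%R, (a * y)%R, (a * z)%R).

Definition pdot (p q : point) : R :=
  let '(x1, y1, z1) := p in let '(x2, y2, z2) := q in
  (x1 * x2 + y1 * y2 + z1 * z2)%R.

Definition dist2 (p q : point) : R :=
  pdot (padd p (pscale (-1) q)) (padd p (pscale (-1) q)).

(* ---------- Finite 2-dimensional simplicial complexes ----------
   A complex on the vertex set 'I_m is given by its set T of triangles
   (3-element vertex sets); its edges and vertices are the faces of the
   triangles (the complex is pure 2-dimensional). *)
Section Complex.
Variable m : nat.
Notation V := 'I_m.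
Variable T : {set {set V}}.

Definition is_edge (e : {set V}) : bool :=
  (#|e| == 2) && [exists t in T, e \subset t].

Definition ntri (e : {set V}) : nat := #|[set t in T | e \subset t]|.

Definition is_bedge (e : {set V}) : bool := is_edge e && (ntri e == 1).

Definition adj : rel V := fun u w => is_edge [set u; w].

Definition link_rel (v : V) : rel V := fun u w => [set u; v; w] \in T.

(* T is a finite connected 2-dim simplicial complex which is a compact
   surface (with boundary): every triangle has 3 vertices, every vertex
   lies in a triangle, the 1-skeleton is connected, every edge lies in at
   most two triangles, and the link of every vertex is connected (hence a
   path or a cycle). *)
Definition is_surface_complex : Prop :=
  T != set0 /\
  [/\ (forall t, t \in T -> #|t| = 3),
      (forall v : V, exists2 t, t \in T & v \in t),
      (forall u w : V, connect adj u w),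
      (forall e, is_edge e -> ntri e <= 2)
    & (forall v u w : V, is_edge [set u; v] -> is_edge [set w; v] ->
         connect (link_rel v) u w)].

(* w : 'I_N -> V (injective; cyclic successor ordS) is the boundary
   cycle, and it is the only boundary component: the boundary edges are
   exactly the pairs of cyclically consecutive vertices of w. *)
Definition is_boundary_cycle (N : nat) (w : 'I_N -> V) : Prop :=
  [/\ 3 <= N, injective w,
      (forall i : 'I_N, is_bedge [set w i; w (ordS i)])
    & (forall e, is_bedge e -> exists i : 'I_N, e = [set w i; w (ordS i)])].
End Complex.

Definition origin : point := (0%R, 0%R, 0%R).

(* A dome over the closed polygon gamma = [v_1 ... v_N] (given as a
   sequence of points, N = size gamma): a triangulated compact connected
   surface with a single boundary cycle, with a map f on its vertices
   (extended linearly on simplices) sending every triangle to a unit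
   equilateral triangle and the boundary cycle vertex by vertex onto gamma. *)
Definition dome_over (gamma : seq point) (m : nat) (T : {set {set 'I_m}})
    (f : 'I_m -> point) (w : 'I_(size gamma) -> 'I_m) : Prop :=
  [/\ is_surface_complex T,
      is_boundary_cycle T w,
      (forall t, t \in T -> forall x y, x \in t -> y \in t -> x != y ->
         dist2 (f x) (f y) = 1%R)
    & (forall i : 'I_(size gamma), f (w i) = nth origin gamma i)].

Definition can_be_domed (gamma : seq point) : Prop :=
  exists m (T : {set {set 'I_m}}) (f : 'I_m -> point)
    (w : 'I_(size gamma) -> 'I_m), dome_over T f w.

(* ---------- The subdivided regular polygon ----------
   Regular n-gon of side length r in the plane through c spanned by the
   orthonormal pair (e1, e2), with phase th: corners
     P_k = c + rho (cos(th + 2 pi k / n) e1 + sin(th + 2 pi k / n) e2),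
   rho = r / (2 sin (pi / n)) the circumradius. Each side [P_k, P_(k+1)]
   is subdivided into r unit segments; the i-th vertex (i = k r + j,
   0 <= j < r) is P_k + (j / r) (P_(k+1) - P_k). *)
Definition orthonormal (e1 e2 : point) : Prop :=
  pdot e1 e1 = 1%R /\ pdot e2 e2 = 1%R /\ pdot e1 e2 = 0%R.

Definition corner (n r : nat) (c e1 e2 : point) (th : R) (k : nat) : point :=
  let rho := (INR r / (2 * sin (PI / INR n)))%R in
  let a := (th + 2 * PI * INR k / INR n)%R in
  padd c (pscale rho (padd (pscale (cos a) e1) (pscale (sin a) e2))).

Definition subdiv_vertex (n r : nat) (c e1 e2 : point) (th : R) (i : nat)
    : point :=
  let k := i %/ r in let j := i %% r in
  padd (corner n r c e1 e2 th k)
    (pscale (INR j / INR r)%R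
       (padd (corner n r c e1 e2 th k.+1)
             (pscale (-1) (corner n r c e1 e2 th k)))).

Definition regular_polygon (n r : nat) (c e1 e2 : point) (th : R)
    : seq point :=
  [seq subdiv_vertex n r c e1 e2 th i | i <- iota 0 (n * r)].

(* Main.v *)
From mathcomp Require Import zify.
From Stdlib Require Import Reals Ranalysis5 Lra Lia Psatz.
From Stdlib Require Import Classical ClassicalEpsilon Relation_Operators.
From mathcomp Require Import all_boot.
Require Import Defs.

Set Implicit Arguments.
Unset Strict Implicit.
Unset Printing Implicit Defensive.

(** A closed unit-edge curve may be modified without changing whether it bounds a
    dome by gluing unit triangles along it: replacing a vertex [b] between [a] and
    [c] by a point at distance 1 from all three ("flip"), or removing [b] when
    [|ac| = 1] ("cut").  If the boundary of the abstract surface has no chords,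
    these gluings again give a simplicial surface without boundary chords.  Read
    as words of edge vectors, the moves are stable under replacing every vector by
    [r] copies of it, which reduces side length [r] to side length 1.

    For side length 1, look for rows of [n] points with [n]-fold symmetry, row [i]
    at radius [x i] and height [z i], consecutive rows being offset by the angle
    [pi / n], such that a point is at distance 1 from its neighbours in the adjacent
    rows and from the point above it two rows further, row 0 being the polygon and
    row [S] a single point on the axis.  Then flips lead from the star of spikes at
    the apex, which bounds a degenerate dome, down to the zigzag through rows 0 and 1,
    and cuts lead to the polygon.

    The first two rows leave one free parameter [y].  For [y = 1/2] the rows repeat
    along vertical lines and never reach the axis.  For [y = y_in] the first step is
    horizontal and inward, and the total variation of the later directions is at
    most a constant times the variation of the squared row gaps, which lies in
    [[3/4, 1]]; so the rows reach the axis.  The intermediate value theorem, applied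
    to the first row that can reach it, gives a row exactly on the axis. *)

(** * Rows of a rotationally symmetric triangulated surface *)

Section Profile.
Local Open Scope R_scope.
Variables s c : R.
Hypothesis s_gt0 : 0 < s.
Hypothesis c_gt0 : 0 < c.
Hypothesis sc1 : s ^ 2 + c ^ 2 = 1.

Definition rho0 := / (2 * s).
(** The positive part of [x], written with [Rabs] so that continuity is immediate. *)
Definition clip (x : R) := (x + Rabs x) / 2.
(** The points at distance 1 from two neighbours in a row of radius [x] form a circle of squared
    radius [1 - s ^ 2 * x ^ 2]; [excess x] is the squared distance from its centre to a unit chord,
    or 0 if there is none. *)
Definition excess (x : R) := clip (3 / 4 - s ^ 2 * x ^ 2).
(** The sense of rotation alternates: a point outside the centre of its circle and a point inside it
    must turn in opposite senses to rise together. *)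
Definition sgn (i : nat) : R := if odd i then -1 else 1.

(* The points at distance 1 from both neighbours of radius x' and height z' form a
   circle about (c x', z') in the half plane; [next_x, next_z] rotates (x, z) along it
   by a chord of length 1.  The clipping only matters where no such chord exists: it
   keeps the formula continuous. *)
Definition next_x (e x z x' z' : R) :=
  let T := / 4 + excess x' in
  c * x' + (1 - / (2 * T)) * (x - c * x') - e * sqrt (excess x') / T * (z - z').
Definition next_z (e x z x' z' : R) :=
  let T := / 4 + excess x' in
  z' + (1 - / (2 * T)) * (z - z') + e * sqrt (excess x') / T * (x - c * x').

(** The recursion has order two, hence the pair of rows. Row 1 is the inner point at height [y] on
    the circle of radius [sqrt (3 / 4)] about [(c * rho0, 0)]. *)
Fixpoint rows (y : R) (i : nat) : (R * R) * (R * R) :=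
  match i with
  | 0%N => ((rho0, 0), (c * rho0 - sqrt (3 / 4 - y ^ 2), y))
  | j.+1 => let: ((x, z), (x', z')) := rows y j in
            ((x', z'), (next_x (sgn j) x z x' z', next_z (sgn j) x z x' z'))
  end.
Definition rx i y := (rows y i).1.1.
Definition rz i y := (rows y i).1.2.

Lemma rowsE y i : rows y i = ((rx i y, rz i y), (rx i.+1 y, rz i.+1 y)).
Proof. by rewrite /rx /rz /=; case: (rows y i) => [[x z] [x' z']]. Qed.

Lemma rx0 y : rx 0 y = rho0. Proof. by []. Qed.
Lemma rz0 y : rz 0 y = 0. Proof. by []. Qed.
Lemma rx1 y : rx 1 y = c * rho0 - sqrt (3 / 4 - y ^ 2). Proof. by []. Qed.
Lemma rz1 y : rz 1 y = y. Proof. by []. Qed.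
Lemma rxSS i y :
  rx i.+2 y = next_x (sgn i) (rx i y) (rz i y) (rx i.+1 y) (rz i.+1 y).
Proof. by rewrite {1}/rx /= rowsE. Qed.
Lemma rzSS i y :
  rz i.+2 y = next_z (sgn i) (rx i y) (rz i y) (rx i.+1 y) (rz i.+1 y).
Proof. by rewrite {1}/rz /= rowsE. Qed.

Lemma sgn_sqr i : sgn i * sgn i = 1.
Proof. by rewrite /sgn; case: (odd i); lra. Qed.
Lemma sgnS i : sgn i.+1 = - sgn i.
Proof. by rewrite /sgn /=; case: (odd i) => /=; lra. Qed.

Lemma clip_ge0 x : 0 <= clip x.
Proof. by rewrite /clip /Rabs; case: Rcase_abs => ?; lra. Qed.
Lemma clip_id x : 0 <= x -> clip x = x.
Proof. by move=> h; rewrite /clip Rabs_pos_eq //; lra. Qed.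
Lemma clip_lt0 x : x < 0 -> clip x = 0.
Proof. by move=> h; rewrite /clip Rabs_left //; lra. Qed.
Lemma excess_ge0 x : 0 <= excess x. Proof. exact: clip_ge0. Qed.

Lemma rho0E : s * rho0 = / 2.
Proof. by rewrite /rho0; field; lra. Qed.
Lemma rho0_gt0 : 0 < rho0.
Proof. by rewrite /rho0; apply: Rinv_0_lt_compat; lra. Qed.

(** Cosine and sine of the angle that a unit chord subtends in a circle of squared radius [T]. *)
Lemma rotation_coef (T E : R) : 0 < T -> E * E = T - / 4 ->
  (1 - / (2 * T)) ^ 2 + (E / T) ^ 2 = 1.
Proof.
move=> T0 hE; rewrite (_ : (E / T) ^ 2 = (E * E) / T ^ 2); last by field; lra.
by rewrite hE; field; lra.
Qed.

(* distance 1 in space between points whose angles differ by [acos c] *)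
Definition unit_cross x z x' z' := x ^ 2 + x' ^ 2 - 2 * c * x * x' + (z - z') ^ 2 = 1.

(** The map is a rotation about [(c * x', z')] for every value of [T], clipped or not, so it keeps
    the distance to that centre, and with it the distance to the row of radius [x']. *)
Lemma unit_cross_next e x z x' z' : e * e = 1 -> unit_cross x z x' z' ->
  unit_cross x' z' (next_x e x z x' z') (next_z e x z x' z').
Proof.
move=> he hQ.
have hX := excess_ge0 x'.
set T := / 4 + excess x'.
have hT : 0 < T by rewrite /T; lra.
have hs := sqrt_sqrt _ hX.
have hrot := @rotation_coef T (e * sqrt (excess x')) hT.
have {}hrot : (1 - / (2 * T)) ^ 2 + (e * sqrt (excess x') / T) ^ 2 = 1.
  apply: hrot.
  have -> : e * sqrt (excess x') * (e * sqrt (excess x')) =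
    (e * e) * (sqrt (excess x') * sqrt (excess x')) by ring.
  by rewrite he hs /T; lra.
rewrite /next_x /next_z -/T.
move: hrot; set C := 1 - _; set D := e * _ / T => hrot.
rewrite /unit_cross in hQ *.
have -> : x' ^ 2 + (c * x' + C * (x - c * x') - D * (z - z')) ^ 2 -
   2 * c * x' * (c * x' + C * (x - c * x') - D * (z - z')) +
   (z' - (z' + C * (z - z') + D * (x - c * x'))) ^ 2 =
   (C ^ 2 + D ^ 2) * ((x - c * x') ^ 2 + (z - z') ^ 2) + (1 - c ^ 2) * x' ^ 2 by ring.
rewrite hrot.
by lra.
Qed.

(** The squared chord times [T] is the squared radius of the circle. Without clipping the latter is
    [T] itself; with clipping [T = / 4] and the radius is below 1/2, so the chord is shorter than
    1. *)
Lemma next_dist e x z x' z' : e * e = 1 -> unit_cross x z x' z' ->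
  let d2 := (next_x e x z x' z' - x) ^ 2 + (next_z e x z x' z' - z) ^ 2 in
  d2 <= 1 /\ (s ^ 2 * x' ^ 2 <= 3 / 4 -> d2 = 1).
Proof.
move=> he hQ d2.
have hX := excess_ge0 x'.
set T := / 4 + excess x'.
have hT : 0 < T by rewrite /T; lra.
have hs := sqrt_sqrt _ hX.
have hd : d2 * T = 1 - s ^ 2 * x' ^ 2.
  rewrite /d2 /next_x /next_z -/T.
  have hE : (e * sqrt (excess x')) * (e * sqrt (excess x')) = T - / 4.
    have -> : e * sqrt (excess x') * (e * sqrt (excess x')) =
      (e * e) * (sqrt (excess x') * sqrt (excess x')) by ring.
    by rewrite he hs /T; lra.
  move: hE; set E := e * sqrt _ => hE.
  have -> : (c * x' + (1 - / (2 * T)) * (x - c * x') - E / T * (z - z') - x) ^ 2 +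
    (z' + (1 - / (2 * T)) * (z - z') + E / T * (x - c * x') - z) ^ 2 =
    (/ 4 + E * E) / T ^ 2 * ((x - c * x') ^ 2 + (z - z') ^ 2) by field; lra.
  rewrite hE.
  have -> : (x - c * x') ^ 2 + (z - z') ^ 2 = 1 - s ^ 2 * x' ^ 2.
    by rewrite /unit_cross in hQ; nra.
  by field; lra.
have hd0 : 0 <= d2 by rewrite /d2; apply: Rplus_le_le_0_compat; exact: pow2_ge_0.
case: (Rle_lt_dec (s ^ 2 * x' ^ 2) (3 / 4)) => h.
  have eT : T = 1 - s ^ 2 * x' ^ 2 by rewrite /T /excess clip_id; lra.
  have e1 : d2 = 1.
    apply: (Rmult_eq_reg_r T); last by lra.
    by rewrite hd eT; ring.
  by split=> //; lra.
have eT : T = / 4 by rewrite /T /excess clip_lt0; lra.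
by split; last lra; move: hd; rewrite eT; lra.
Qed.

Lemma rows_unit y i : 0 <= 3 / 4 - y ^ 2 ->
  unit_cross (rx i y) (rz i y) (rx i.+1 y) (rz i.+1 y).
Proof.
move=> hy; elim: i => [|i IH].
  rewrite rx0 rz0 rx1 rz1 /unit_cross.
  have hs := sqrt_sqrt _ hy.
  set t := sqrt _ in hs *.
  have -> : rho0 ^ 2 + (c * rho0 - t) ^ 2 - 2 * c * rho0 * (c * rho0 - t) + (0 - y) ^ 2
    = (1 - c ^ 2) * rho0 ^ 2 + t * t + y ^ 2 by ring.
  rewrite hs.
  have -> : 1 - c ^ 2 = s ^ 2 by lra.
  have -> : s ^ 2 * rho0 ^ 2 = (s * rho0) ^ 2 by ring.
  by rewrite rho0E; field.
by rewrite rxSS rzSS; apply: unit_cross_next => //; exact: sgn_sqr.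
Qed.

Lemma rows_step y i : 0 <= 3 / 4 - y ^ 2 ->
  let d2 := (rx i.+2 y - rx i y) ^ 2 + (rz i.+2 y - rz i y) ^ 2 in
  d2 <= 1 /\ (s ^ 2 * (rx i.+1 y) ^ 2 <= 3 / 4 -> d2 = 1).
Proof.
move=> hy; rewrite rxSS rzSS; apply: next_dist (sgn_sqr i) (rows_unit i hy).
Qed.

(** * Continuous dependence of the rows on the initial height *)

Lemma continuity_clip : continuity clip.
Proof.
move=> x; rewrite /clip /Rdiv.
apply: (continuity_pt_mult (fun x => x + Rabs x) (fun _ => / 2)).
  apply: (continuity_pt_plus (fun x => x) Rabs).
    exact: (derivable_continuous_pt _ _ (derivable_pt_id x)).
  exact: Rcontinuity_abs.
by apply: continuity_pt_const => ? ?.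
Qed.

Lemma rows_continuous i y : 0 < 3 / 4 - y ^ 2 ->
  continuity_pt (rx i) y /\ continuity_pt (rz i) y.
Proof.
move=> hy.
have cid : continuity_pt (fun y => y) y
  by exact: (derivable_continuous_pt _ _ (derivable_pt_id y)).
have cc k : continuity_pt (fun _ : R => k) y by apply: continuity_pt_const => ? ?.
have cadd f g : continuity_pt f y -> continuity_pt g y ->
  continuity_pt (fun t => f t + g t) y by exact: continuity_pt_plus.
have csub f g : continuity_pt f y -> continuity_pt g y ->
  continuity_pt (fun t => f t - g t) y by exact: continuity_pt_minus.
have cmul f g : continuity_pt f y -> continuity_pt g y ->
  continuity_pt (fun t => f t * g t) y by exact: continuity_pt_mult.
have cinv f : continuity_pt f y -> f y <> 0 ->
  continuity_pt (fun t => / f t) y by exact: continuity_pt_inv.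
have csq f : continuity_pt f y -> continuity_pt (fun t => (f t) ^ 2) y.
  by move=> h; apply: (cmul f (fun t => f t * 1)) => //; exact: cmul.
have csqrt f : continuity_pt f y -> 0 <= f y -> continuity_pt (fun t => sqrt (f t)) y.
  move=> h h0; apply: (continuity_pt_comp f sqrt) => //.
  exact: continuity_pt_sqrt.
suff H : (continuity_pt (rx i) y /\ continuity_pt (rz i) y) /\
         (continuity_pt (rx i.+1) y /\ continuity_pt (rz i.+1) y) by case: H.
elim: i => [|i [[h1 h2] [h3 h4]]].
  split; split.
  - exact: cc.
  - exact: cc.
  - change (continuity_pt (fun t => c * rho0 - sqrt (3 / 4 - t ^ 2)) y).
    refine (csub _ _ _ _); first exact: cc.
    refine (csqrt _ _ _); last lra.
    by refine (csub _ _ _ _); [exact: cc | exact: csq].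
  - exact: cid.
split=> //.
have cX : continuity_pt (fun t => excess (rx i.+1 t)) y.
  apply: (continuity_pt_comp (fun t => 3 / 4 - s ^ 2 * rx i.+1 t ^ 2) clip).
    refine (csub _ _ _ _); first exact: cc.
    by refine (cmul _ _ _ _); [exact: cc | exact: csq].
  exact: continuity_clip.
have X0 := excess_ge0 (rx i.+1 y).
have cT : continuity_pt (fun t => / 4 + excess (rx i.+1 t)) y.
  by refine (cadd _ _ _ _); [exact: cc|].
have cS : continuity_pt (fun t => sgn i * sqrt (excess (rx i.+1 t)) /
                                  (/ 4 + excess (rx i.+1 t))) y.
  refine (cmul _ _ _ _); last by refine (cinv _ _ _) => //; lra.
  by refine (cmul _ _ _ _); [exact: cc | refine (csqrt _ _ _)].
have cC : continuity_pt (fun t => 1 - / (2 * (/ 4 + excess (rx i.+1 t)))) y.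
  refine (csub _ _ _ _); first exact: cc.
  refine (cinv _ _ _); last by lra.
  by refine (cmul _ _ _ _); [exact: cc|].
have ext f g : (forall t, f t = g t) -> continuity_pt g y -> continuity_pt f y.
  by move=> h; apply: (@continuity_pt_locally_ext g f 1) => //; lra.
split.
  apply: (ext _ _ (fun t => rxSS i t)); rewrite /next_x.
  refine (csub _ _ _ _); last by refine (cmul _ _ _ _) => //; exact: csub.
  refine (cadd _ _ _ _); first by refine (cmul _ _ _ _); [exact: cc|].
  refine (cmul _ _ _ _) => //; refine (csub _ _ _ _) => //.
  by refine (cmul _ _ _ _); [exact: cc|].
apply: (ext _ _ (fun t => rzSS i t)); rewrite /next_z.
refine (cadd _ _ _ _); first by refine (cadd _ _ _ _) => //; refine (cmul _ _ _ _) => //; exact: csub.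
refine (cmul _ _ _ _) => //; refine (csub _ _ _ _) => //.
by refine (cmul _ _ _ _); [exact: cc|].
Qed.

(** * Rows for an angle below 30 degrees *)

Hypothesis steep : 3 * s ^ 2 < c ^ 2.

Lemma s_lt : s < / 2. Proof. by nra. Qed.
Lemma c_gt : 866 / 1000 < c. Proof. by have := s_lt; nra. Qed.
Lemma rho0_gt1 : 1 < rho0.
Proof. by have := s_lt; have := rho0E; have := rho0_gt0; nra. Qed.
(** The middle term is [(1 - c) / s], the tangent of half the angle, hence below the tangent of 15
    degrees, which is [2 - sqrt 3 < 0.268]. It bounds the change of the squared row gap per row. *)
Lemma mu_rho0 : 0 <= 2 * (1 - c) * rho0 <= 268 / 1000.
Proof.
have h1 := s_lt; have h2 := c_gt; have h3 := rho0E; have h4 := rho0_gt0.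
have h5 : 2 * (1 - c) * rho0 * s = 1 - c by nra.
have h6 : 1 - c <= 268 / 1000 * s by nra.
have h7 : c < 1 by nra.
split; first by nra.
apply: (Rmult_le_reg_r s) => //; lra.
Qed.

(** The apothem [c * rho0] exceeds [sqrt (3 / 4)], since [3 * (s * rho0) ^ 2 = 3 / 4]. *)
Lemma rx1_gt0 y : 0 < rx 1 y.
Proof.
rewrite rx1.
have hsq : sqrt (3 / 4 - y ^ 2) <= sqrt (3 / 4).
  case: (Rle_lt_dec 0 (3 / 4 - y ^ 2)) => h.
    by apply: sqrt_le_1; have := pow2_ge_0 y; lra.
  by rewrite sqrt_neg_0; [exact: sqrt_pos | lra].
suff : sqrt (3 / 4) < c * rho0 by lra.
have h1 := sqrt_sqrt (3 / 4); have h2 := sqrt_pos (3 / 4).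
have h3 : 3 / 4 < (c * rho0) ^ 2.
  have h4 : 3 * (s * rho0) ^ 2 < (c * rho0) ^ 2.
    have := rho0_gt0.
    rewrite (_ : 3 * (s * rho0) ^ 2 = 3 * s ^ 2 * rho0 ^ 2); last by ring.
    rewrite (_ : (c * rho0) ^ 2 = c ^ 2 * rho0 ^ 2); last by ring.
    move=> h; apply: Rmult_lt_compat_r => //; nra.
  by move: h4; rewrite rho0E; lra.
have r0 := rho0_gt0; apply: Rnot_le_lt => hle.
have h5 : 0 <= c * rho0 by nra.
have h6 : (c * rho0) ^ 2 <= (sqrt (3 / 4)) ^ 2 by apply: pow_incr.
have : sqrt (3 / 4) * sqrt (3 / 4) = 3 / 4 by apply: h1; lra.
lra.
Qed.

Lemma rx1_le y : rx 1 y <= rho0.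
Proof.
rewrite rx1; have := sqrt_pos (3 / 4 - y ^ 2); have := rho0_gt0.
have : c < 1 by nra.
nra.
Qed.

Lemma excess_small x : 0 <= x <= rho0 ->
  excess x = 3 / 4 - s ^ 2 * x ^ 2 /\ / 2 <= excess x.
Proof.
move=> [h1 h2].
have h3 : s * x <= / 2 by rewrite -rho0E; nra.
have h4 : 0 <= s * x by nra.
have h5 : s ^ 2 * x ^ 2 <= / 4 by rewrite (_ : s ^ 2 * x ^ 2 = (s * x) ^ 2); [nra | ring].
by rewrite /excess clip_id; lra.
Qed.

(** At [y = / 2] each point lies 1/2 below the centre of its circle, so the unit chord from it is
    vertical and leads to its mirror image 1/2 above the centre. *)
Lemma rows_vertical i :
  rx i.+2 (/ 2) = rx i (/ 2) /\ rz i.+2 (/ 2) = rz i (/ 2) + 1.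
Proof.
pose x1 := rx 1 (/ 2).
have x1p : 0 < x1 := rx1_gt0 (/ 2).
have x1l : x1 <= rho0 := rx1_le (/ 2).
have c1 : c < 1 by nra.
have hx1 : c * rho0 - x1 = sqrt (/ 2).
  rewrite /x1 rx1 (_ : 3 / 4 - (/ 2) ^ 2 = / 2); [ring | field].
have hs2 : 0 < sqrt (/ 2) by apply: sqrt_lt_R0; lra.
have r0 := rho0_gt0.
have key e x x' z : (e = 1 /\ 0 < x - c * x' \/ e = -1 /\ x - c * x' < 0) ->
  0 < x <= rho0 -> 0 < x' <= rho0 -> unit_cross x z x' (z + / 2) ->
  next_x e x z x' (z + / 2) = x /\ next_z e x z x' (z + / 2) = z + 1.
  move=> he hx hx' hQ.
  have [eX hX] := @excess_small x' (conj (Rlt_le _ _ hx'.1) hx'.2).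
  have eX2 : excess x' = (x - c * x') ^ 2.
    by rewrite eX; rewrite /unit_cross in hQ; nra.
  have e2 : e * sqrt (excess x') = x - c * x'.
    rewrite eX2; case: he => [[-> h]|[-> h]].
      by rewrite sqrt_pow2; lra.
    rewrite (_ : (x - c * x') ^ 2 = (c * x' - x) ^ 2); last by ring.
    by rewrite sqrt_pow2; lra.
  rewrite /next_x /next_z e2 eX2.
  move: eX2 hX; set d := x - c * x' => eX2 hX.
  have hd : / 4 + d ^ 2 <> 0 by have := pow2_ge_0 d; lra.
  have hd2 := pow2_ge_0 d.
  split; last by field; lra.
  by rewrite [RHS](_ : x = c * x' + d); [field; lra | rewrite /d; ring].
have hodd : forall j, rx j (/ 2) = (if odd j then x1 else rho0) ->
   rx j.+1 (/ 2) = (if odd j then rho0 else x1) ->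
   rz j.+1 (/ 2) = rz j (/ 2) + / 2 ->
   rx j.+2 (/ 2) = rx j (/ 2) /\ rz j.+2 (/ 2) = rz j (/ 2) + 1.
  move=> j h1 h2 h3; rewrite rxSS rzSS h3.
  have hQ := @rows_unit (/ 2) j; rewrite h3 in hQ.
  have {}hQ : unit_cross (rx j (/ 2)) (rz j (/ 2)) (rx j.+1 (/ 2)) (rz j (/ 2) + / 2).
    by apply: hQ; lra.
  apply: key hQ; rewrite ?h1 ?h2.
  - by rewrite /sgn; case: (odd j); [right; lra | left; split=> //; nra].
  - by case: (odd j); lra.
  - by case: (odd j); lra.
apply: (proj1 (_ : (_ /\ _) /\ (rx i (/ 2) = (if odd i then x1 else rho0) /\
   rx i.+1 (/ 2) = (if odd i then rho0 else x1) /\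
   rz i.+1 (/ 2) = rz i (/ 2) + / 2))).
elim: i => [|i [[h1 h2] [h3 [h4 h5]]]].
  have a : rz 1 (/ 2) = rz 0 (/ 2) + / 2 by rewrite rz0 rz1; lra.
  by split; [exact: hodd | split].
have a1 : rx i.+1 (/ 2) = (if odd i.+1 then x1 else rho0) by rewrite /= h4; case: (odd i).
have a2 : rx i.+2 (/ 2) = (if odd i.+1 then rho0 else x1) by rewrite /= h1 h3; case: (odd i).
have a3 : rz i.+2 (/ 2) = rz i.+1 (/ 2) + / 2 by rewrite h2 h5; lra.
by split; [exact: hodd | split].
Qed.

Lemma rx_vertical_gt0 i : 0 < rx i (/ 2).
Proof.
suff : 0 < rx i (/ 2) /\ 0 < rx i.+1 (/ 2) by case.
elim: i => [|i [h1 h2]].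
  by split; [exact: rho0_gt0 | exact: rx1_gt0].
by split=> //; rewrite (rows_vertical i).1.
Qed.

(** * Rows that start inward *)

Definition y_in := - sqrt (3 / 4 - ((1 - s) / (2 * c)) ^ 2).

Lemma y_in_facts : [/\ 0 < 3 / 4 - y_in ^ 2, y_in <= 0,
  sqrt (3 / 4 - y_in ^ 2) = (1 - s) / (2 * c) &
  - y_in = sqrt (3 / 4 - ((1 - s) / (2 * c)) ^ 2)].
Proof.
have h1 := s_lt; have h2 := c_gt.
have h3 : 0 < (1 - s) / (2 * c) by apply: Rdiv_lt_0_compat; lra.
have h4 : (1 - s) / (2 * c) <= 6 / 10.
  apply: (Rmult_le_reg_r (2 * c)); first lra.
  rewrite /Rdiv Rmult_assoc Rinv_l; nra.
rewrite /y_in; set t := (1 - s) / (2 * c) in h3 h4 *.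
have h5 : 0 <= 3 / 4 - t ^ 2 by nra.
have h6 : 3 / 4 - (- sqrt (3 / 4 - t ^ 2)) ^ 2 = t ^ 2.
  have := sqrt_sqrt _ h5; nra.
split; rewrite ?h6.
- by nra.
- by have := sqrt_pos (3 / 4 - t ^ 2); lra.
- by rewrite sqrt_pow2; lra.
- by lra.
Qed.

(** The height [y_in] is obtained by placing the centre [(c * rx 1, y)] under the midpoint of the
    horizontal chord from [rho0] to [rho0 - 1]. Its negative sign puts the centre below the chord,
    so that the first rotation leads inward. *)
Lemma rows_inward_start :
  [/\ c * rx 1 y_in = rho0 - / 2, rx 2 y_in = rho0 - 1 & rz 2 y_in = 0].
Proof.
have [h1 h2 h3 h4] := y_in_facts.
have e1 : c * rx 1 y_in = rho0 - / 2.
  rewrite rx1 h3.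
  have -> : c * (c * rho0 - (1 - s) / (2 * c)) = c ^ 2 * rho0 - (1 - s) / 2 by field; lra.
  have -> : c ^ 2 = 1 - s * s by lra.
  by have := rho0E; nra.
have hx1 : 0 <= rx 1 y_in <= rho0 by have := rx1_gt0 y_in; have := rx1_le y_in; lra.
have [eX hX] := excess_small hx1.
have hQ := @rows_unit y_in 0 (Rlt_le _ _ h1).
rewrite /unit_cross rx0 rz0 rz1 in hQ.
have eX2 : excess (rx 1 y_in) = y_in ^ 2.
  rewrite eX.
  have : (rho0 - c * rx 1 y_in) ^ 2 = / 4 by rewrite e1; field.
  nra.
have hd : / 4 + y_in ^ 2 <> 0 by have := pow2_ge_0 y_in; lra.
have hy : sqrt (y_in ^ 2) = - y_in.
  by rewrite (_ : y_in ^ 2 = (- y_in) ^ 2); [rewrite sqrt_pow2; lra | ring].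
split=> //; rewrite ?rxSS ?rzSS rx0 rz0 rz1 /next_x /next_z e1 eX2 hy /sgn /=; field; have := pow2_ge_0 y_in; lra.
Qed.

(** [D0] and [D1] are successive changes of the squared row gap, [Z0] and [Z1] the cross products of
    the gap vector with two successive unit steps. Factoring [Z0 ^ 2 - Z1 ^ 2] bounds [Z0 - Z1] by
    half of [D0 + D1]; the left side is then at most [(D0 + D1) ^ 2 / 2], and [3 / 4 * 25 / 36]
    exceeds 1/2. *)
Lemma direction_change (q D0 D1 Z0 Z1 : R) :
  3 / 4 + D0 <= q -> 0 <= D0 <= 268 / 1000 -> - (268 / 1000) <= D1 <= 268 / 1000 ->
  0 <= Z0 -> 0 <= Z1 ->
  Z0 ^ 2 = q - ((1 + D0) / 2) ^ 2 -> Z1 ^ 2 = q - ((1 - D1) / 2) ^ 2 ->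
  ((D0 + D1) / 2) ^ 2 + (Z0 - Z1) ^ 2 <= q * (25 / 36 * (D0 + D1) ^ 2).
Proof.
move=> hq h0 h1 hZ0 hZ1 e0 e1.
(* [Z0 ^ 2] is at least [1 / 2 + D0 / 2 - D0 ^ 2 / 4 >= 1 / 2], and [Z1 ^ 2] at least
   [3 / 4 - (634 / 1000) ^ 2]. Their sum [Z0 + Z1] thus exceeds 1.287, against at most 1.268 for the
   other factor. *)
have a0 : 707 / 1000 <= Z0 by nra.
have a1 : 58 / 100 <= Z1 by nra.
have e2 : (Z0 - Z1) * (Z0 + Z1) = - ((D0 + D1) / 2) * ((2 + D0 - D1) / 2) by nra.
set d := (D0 + D1) / 2 in e2 *.
have b : (Z0 - Z1) ^ 2 <= d ^ 2.
  have h : ((Z0 - Z1) * (Z0 + Z1)) ^ 2 <= d ^ 2 * (1268 / 1000) ^ 2.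
    rewrite e2 (_ : (- d * ((2 + D0 - D1) / 2)) ^ 2 = d ^ 2 * ((2 + D0 - D1) / 2) ^ 2);
      last by ring.
    apply: Rmult_le_compat_l; first exact: pow2_ge_0.
    by nra.
  have h' : (Z0 - Z1) ^ 2 * (1287 / 1000) ^ 2 <= ((Z0 - Z1) * (Z0 + Z1)) ^ 2.
    rewrite (_ : ((Z0 - Z1) * (Z0 + Z1)) ^ 2 = (Z0 - Z1) ^ 2 * (Z0 + Z1) ^ 2); last by ring.
    apply: Rmult_le_compat_l; first exact: pow2_ge_0.
    by nra.
  have := pow2_ge_0 d; nra.
have -> : D0 + D1 = 2 * d by rewrite /d; field.
have := pow2_ge_0 d; nra.
Qed.
(** Taken from the centre [(c * x', z')], the cross product with the step is [e * sqrt (excess x')],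
    at least 0.7 in size. Moving the base point to [(x', z')] changes it by at most 0.134, so the
    sign [e] survives. *)
Lemma next_cross e x z x' z' : e * e = 1 -> unit_cross x z x' z' -> 0 <= x' <= rho0 ->
  let nx := next_x e x z x' z' in let nz := next_z e x z x' z' in
  0 < e * ((nx - x') * (nz - z) - (nz - z') * (nx - x)).
Proof.
move=> he hQ hx' nx nz.
have [d1 _] := next_dist he hQ; rewrite -/nx -/nz in d1.
have [eX hX] := excess_small hx'.
set T := / 4 + excess x'.
have hT : 0 < T by rewrite /T; lra.
have eT : (x - c * x') ^ 2 + (z - z') ^ 2 = T.
  by rewrite /T eX; rewrite /unit_cross in hQ; nra.
have -> : (nx - x') * (nz - z) - (nz - z') * (nx - x) =
    e * sqrt (excess x') - (1 - c) * x' * (nz - z).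
  have -> : e * sqrt (excess x') =
     e * sqrt (excess x') / T * ((x - c * x') ^ 2 + (z - z') ^ 2).
    by rewrite eT; field; lra.
  by rewrite /nx /nz /next_x /next_z -/T; ring.
have h1 : 7 / 10 <= sqrt (excess x').
  rewrite -(sqrt_pow2 (7 / 10)); last lra.
  by apply: sqrt_le_1; lra.
have h2 : - 1 <= nz - z <= 1.
  have := pow2_ge_0 (nx - x); split; nra.
have h3 : 0 <= (1 - c) * x' <= 134 / 1000.
  have hm := mu_rho0; have : c < 1 by nra.
  move=> hc; split; nra.
have h4 : - (134 / 1000) <= (1 - c) * x' * (nz - z) <= 134 / 1000 by split; nra.
have he' : e = 1 \/ e = -1.
  have : (e - 1) * (e + 1) = 0 by lra.
  by case/Rmult_integral => ?; [left | right]; lra.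
by case: he' => ->; lra.
Qed.

(** The change of the unit step is resolved along and across the gap vector [(g, h)]. Inner products
    come from the squared gaps, cross products up to sign from Lagrange's identity; the common sign
    [sg] allows their difference to be estimated. *)
Lemma direction_change_plane (g h a b a' b' q q0 q2 sg : R) :
  sg * sg = 1 -> g ^ 2 + h ^ 2 = q -> a ^ 2 + b ^ 2 = 1 -> a' ^ 2 + b' ^ 2 = 1 ->
  (g - a) ^ 2 + (h - b) ^ 2 = q0 -> (a' - g) ^ 2 + (b' - h) ^ 2 = q2 ->
  0 <= sg * (g * b - h * a) -> 0 <= sg * (g * b' - h * a') ->
  3 / 4 <= q0 -> 0 <= q - q0 <= 268 / 1000 -> - (268 / 1000) <= q2 - q <= 268 / 1000 ->
  (a' - a) ^ 2 + (b' - b) ^ 2 <= (5 / 6 * (q2 - q0)) ^ 2.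
Proof.
move=> hsg hq hv hv' hq0 hq2 hc hc' h0 h1 h2.
have d0 : g * a + h * b = (1 + (q - q0)) / 2 by nra.
have d1 : g * a' + h * b' = (1 - (q2 - q)) / 2 by nra.
have lag x y : (sg * (g * y - h * x)) ^ 2 = q * (x ^ 2 + y ^ 2) - (g * x + h * y) ^ 2.
  have -> : (sg * (g * y - h * x)) ^ 2 = (sg * sg) * (g * y - h * x) ^ 2 by ring.
  by rewrite hsg -hq; ring.
have e0 := lag a b; have e1 := lag a' b'; rewrite hv d0 Rmult_1_r in e0.
rewrite hv' d1 Rmult_1_r in e1.
have H := @direction_change q (q - q0) (q2 - q) _ _ _ h1 h2 hc hc' e0 e1.
have {}H : ((q2 - q0) / 2) ^ 2 + (sg * (g * b - h * a) - sg * (g * b' - h * a')) ^ 2 <=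
   q * (25 / 36 * (q2 - q0) ^ 2).
  by have := H ltac:(lra); rewrite (_ : q - q0 + (q2 - q) = q2 - q0); [| ring].
have L := lag (a' - a) (b' - b).
have e2 : g * (a' - a) + h * (b' - b) = - ((q2 - q0) / 2) by lra.
rewrite e2 in L.
have e3 : (sg * (g * (b' - b) - h * (a' - a))) ^ 2 =
  (sg * (g * b - h * a) - sg * (g * b' - h * a')) ^ 2 by ring.
rewrite e3 in L.
apply: (Rmult_le_reg_l q); first lra.
lra.
Qed.

Lemma norm_triangle (a b a' b' A B : R) : 0 <= A -> 0 <= B ->
  a ^ 2 + b ^ 2 <= A ^ 2 -> a' ^ 2 + b' ^ 2 <= B ^ 2 ->
  (a + a') ^ 2 + (b + b') ^ 2 <= (A + B) ^ 2.
Proof.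
move=> hA hB h1 h2.
have h3 : a * a' + b * b' <= A * B.
  apply: Rnot_lt_le => h4.
  have h5 : 0 <= A * B by nra.
  have h6 : (A * B) ^ 2 < (a * a' + b * b') ^ 2 by nra.
  have h7 : (a * a' + b * b') ^ 2 <= (a ^ 2 + b ^ 2) * (a' ^ 2 + b' ^ 2).
    by have := pow2_ge_0 (a * b' - b * a'); lra.
  have h8 : (a ^ 2 + b ^ 2) * (a' ^ 2 + b' ^ 2) <= A ^ 2 * B ^ 2.
    by apply: Rmult_le_compat => //; apply: Rplus_le_le_0_compat; exact: pow2_ge_0.
  lra.
lra.
Qed.

Lemma sqr_le_of_abs a b : - b <= a <= b -> a ^ 2 <= b ^ 2.
Proof. nra. Qed.

Lemma abs_le_of_sqr a b : 0 <= b -> a ^ 2 <= b ^ 2 -> - b <= a <= b.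
Proof. by move=> h1 h2; split; nra. Qed.

Lemma mul_unit_bound m w b : 0 <= m <= b -> 0 <= w <= 1 -> 0 <= m * w <= b.
Proof. by move=> h1 h2; split; nra. Qed.

Lemma mul_sunit_bound m w b : 0 <= m <= b -> - 1 <= w <= 1 -> - b <= m * w <= b.
Proof. by move=> h1 h2; split; nra. Qed.

Lemma mu_row a m b x : 0 <= m * a <= b -> 0 <= m -> 0 < x <= a -> 0 <= m * x <= b.
Proof. by move=> h1 h2 h3; split; nra. Qed.

Section Inward.
Notation X k := (rx k y_in).
Notation Z k := (rz k y_in).
Let q k := 1 - 2 * (1 - c) * X k * X k.+1.

Variable K : nat.
Hypothesis Xpos : forall k, (k <= K)%N -> 0 < X k.

Let y_ok : 0 <= 3 / 4 - y_in ^ 2.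
Proof. by case: y_in_facts => h _ _ _; lra. Qed.

Lemma row_gap k : (X k - X k.+1) ^ 2 + (Z k - Z k.+1) ^ 2 = q k.
Proof. have := rows_unit k y_ok; rewrite /unit_cross /q; nra. Qed.

(** Multiplying by [c * s ^ 2] and inserting [c * X 1 = rho0 - / 2] leaves
    [2 * (1 - s) <= c * (1 + c)]. Equality holds at [s = 0]: [3 / 4] is the limit for small
    angles. *)
Lemma q_start : 3 / 4 <= q 0.
Proof.
have [h1 _ _] := rows_inward_start.
have h2 := rho0E; have h3 := rho0_gt0; have h4 := c_gt.
rewrite /q rx0.
have h5 : c * (4 * (1 - c) * rho0 * (2 * X 1)) = 4 * (1 - c) * rho0 * (2 * rho0 - 1).
  by rewrite (_ : c * _ = 4 * (1 - c) * rho0 * (2 * (c * X 1))); [rewrite h1; field | ring].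
have h6 : 4 * (1 - c) * rho0 * (2 * rho0 - 1) * (s * s) = 2 * (1 - c) * (1 - s).
  have -> : 4 * (1 - c) * rho0 * (2 * rho0 - 1) * (s * s) =
    4 * (1 - c) * (s * rho0) * (2 * (s * rho0) - s) by ring.
  by rewrite h2; field.
have h7 : s * s = (1 - c) * (1 + c) by lra.
have hs := s_lt; have c1 : c < 1 by nra.
have h8 : 2 * (1 - c) * (1 - s) <= c * (s * s).
  rewrite h7.
  suff : 2 * (1 - s) <= c * (1 + c) by move=> h; nra.
  nra.
have h9 : c * (4 * (1 - c) * rho0 * (2 * X 1)) <= c * 1.
  apply: (Rmult_le_reg_r (s * s)); first nra.
  by rewrite h5 h6; lra.
have := Rmult_le_reg_l _ _ _ c_gt0 h9; lra.
Qed.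

(** From step [k] to step [k + 1] the direction changes by at most [5/6 (q (k + 2) - q k)]. These
    bounds telescope, so the direction stays near [(-1, 0)]; inward steps in turn keep [q]
    increasing, which closes the induction. *)
Lemma inward_invariant i : (i.+2 <= K)%N ->
  [/\ X i <= rho0 /\ X i.+1 <= rho0, 3 / 4 <= q i /\ q i <= q i.+1,
      (X i.+2 - X i + 1) ^ 2 + (Z i.+2 - Z i) ^ 2 <=
        (5 / 6 * (q i + q i.+1 - q 0 - q 1)) ^ 2,
      q 0 <= q i /\ q 1 <= q i.+1
    & X i.+2 <= X i - 9 / 10].
Proof.
have hm := mu_rho0; have c1 : c < 1 by nra.
have qlt k : (k.+1 <= K)%N -> q k <= 1.
  move=> hk; have a := Xpos hk; have b := Xpos (ltnW hk).
  by rewrite /q; have : 0 <= (1 - c) * X k * X k.+1; [apply: Rmult_le_pos; nra | lra].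
have q0 := q_start.
have speed k : (k.+2 <= K)%N -> 3 / 4 <= q 1 -> X k.+1 <= rho0 ->
   q 0 <= q k -> q 1 <= q k.+1 ->
   (X k.+2 - X k + 1) ^ 2 + (Z k.+2 - Z k) ^ 2 <= (5 / 6 * (q k + q k.+1 - q 0 - q 1)) ^ 2 ->
   X k.+2 <= X k - 9 / 10.
  move=> hk h1 h2 h3 h4 h5.
  have a := qlt k (ltnW hk); have b := qlt k.+1 hk.
  have [_ h6] := rows_step k y_ok.
  have x1 := Xpos (ltnW hk).
  have [eX hX] := excess_small (conj (Rlt_le _ _ x1) h2).
  have {}h6 := h6 ltac:(rewrite eX in hX; lra).
  (* As [q] lies between 3/4 and 1, the bracket is at most 1/2. A unit vector within 5/12 of
     [(-1, 0)] has first coordinate at most [-1 + 25/288 < -9/10]. *)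
  have h7 : (5 / 6 * (q k + q k.+1 - q 0 - q 1)) ^ 2 <= (5 / 12) ^ 2.
    by apply: pow_incr; lra.
  nra.
have q01 : q 0 <= q 1.
  have [_ e2 _] := rows_inward_start; have := rx1_gt0 y_in.
  rewrite /q e2 rx0 => x1; have : 0 <= (1 - c) * X 1 by nra.
  nra.
elim: i => [|i IH] hK.
  have [e1 e2 e3] := rows_inward_start.
  have r1 := rho0_gt1.
  have x1 := Xpos (ltnW hK).
  have hx1 : X 1 <= rho0 := rx1_le _.
  split=> //; try lra.
  - by rewrite rx0; split=> //; lra.
  - rewrite e2 e3 rx0 rz0; rewrite (_ : (_ - _ + 1) ^ 2 + _ = 0); last by ring.
    exact: pow2_ge_0.
  - by rewrite e2 rx0; lra.
have [[h1 h2] [h3 h4] h5 [h6 h6'] h7] := IH (ltnW hK).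
have x0 := Xpos (ltnW (ltnW (ltnW hK))).
have x1 := Xpos (ltnW (ltnW hK)).
have x2 := Xpos (ltnW hK).
have x3 := Xpos hK.
have hx2 : X i.+2 <= rho0 by lra.
have [_ u0] := rows_step i y_ok.
have [_ u1] := rows_step i.+1 y_ok.
have [eX hX] := excess_small (conj (Rlt_le _ _ x1) h2).
have [eX' hX'] := excess_small (conj (Rlt_le _ _ x2) hx2).
have {}u0 := u0 ltac:(rewrite eX in hX; lra).
have {}u1 := u1 ltac:(rewrite eX' in hX'; lra).
have dq0 : q i.+1 - q i = 2 * (1 - c) * X i.+1 * (X i - X i.+2) by rewrite /q; ring.
have dq1 : q i.+2 - q i.+1 = 2 * (1 - c) * X i.+2 * (X i.+1 - X i.+3) by rewrite /q; ring.
have v0 := @abs_le_of_sqr (X i.+2 - X i) 1 ltac:(lra)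
  ltac:(have := pow2_ge_0 (Z i.+2 - Z i); lra).
have v1 := @abs_le_of_sqr (X i.+3 - X i.+1) 1 ltac:(lra)
  ltac:(have := pow2_ge_0 (Z i.+3 - Z i.+1); lra).
have m1 : 0 <= 2 * (1 - c) * X i.+1 <= 268 / 1000.
  by apply: (mu_row hm) => //; lra.
have m2 : 0 <= 2 * (1 - c) * X i.+2 <= 268 / 1000.
  by apply: (mu_row hm) => //; lra.
have b0 : 0 <= q i.+1 - q i <= 268 / 1000.
  by rewrite dq0; apply: mul_unit_bound => //; lra.
have b1 : - (268 / 1000) <= q i.+2 - q i.+1 <= 268 / 1000.
  by rewrite dq1; apply: mul_sunit_bound => //; lra.
have cr0 := next_cross (sgn_sqr i) (rows_unit i y_ok) (conj (Rlt_le _ _ x1) h2).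
have cr1 := next_cross (sgn_sqr i.+1) (rows_unit i.+1 y_ok) (conj (Rlt_le _ _ x2) hx2).
rewrite /= -!rxSS -!rzSS in cr0 cr1; rewrite sgnS in cr1.
have D : (X i.+3 - X i.+1 - (X i.+2 - X i)) ^ 2 + (Z i.+3 - Z i.+1 - (Z i.+2 - Z i)) ^ 2
    <= (5 / 6 * (q i.+2 - q i)) ^ 2.
  apply: (@direction_change_plane (X i.+2 - X i.+1) (Z i.+2 - Z i.+1) _ _ _ _ (q i.+1)
    (q i) (q i.+2) (sgn i)) => //; try exact: sgn_sqr; try lra.
  - by rewrite -row_gap; ring.
  - by rewrite -(row_gap i); ring.
  - by rewrite -(row_gap i.+2); ring.
have hq : q i.+1 <= q i.+2.
  (* The change of direction is at most [5/6 * 2 * 0.268 < 0.448], too small to turn a step of at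
     least 9/10 inward into an outward one. *)
  suff h : 0 <= X i.+1 - X i.+3 by have := Rmult_le_pos _ _ m2.1 h; lra.
  have B : (5 / 6 * (q i.+2 - q i)) ^ 2 <= (448 / 1000) ^ 2 by apply: sqr_le_of_abs; lra.
  have sq := pow2_ge_0 (Z i.+3 - Z i.+1 - (Z i.+2 - Z i)).
  have := @abs_le_of_sqr (X i.+3 - X i.+1 - (X i.+2 - X i)) (448 / 1000) ltac:(lra) ltac:(lra).
  lra.
have C : (X i.+3 - X i.+1 + 1) ^ 2 + (Z i.+3 - Z i.+1) ^ 2 <=
    (5 / 6 * (q i.+1 + q i.+2 - q 0 - q 1)) ^ 2.
  have N := @norm_triangle (X i.+2 - X i + 1) (Z i.+2 - Z i)
    (X i.+3 - X i.+1 - (X i.+2 - X i)) (Z i.+3 - Z i.+1 - (Z i.+2 - Z i))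
    (5 / 6 * (q i + q i.+1 - q 0 - q 1)) (5 / 6 * (q i.+2 - q i))
    ltac:(lra) ltac:(lra) h5 D.
  rewrite (_ : X i.+3 - X i.+1 + 1 =
    X i.+2 - X i + 1 + (X i.+3 - X i.+1 - (X i.+2 - X i))); last by ring.
  rewrite (_ : Z i.+3 - Z i.+1 = Z i.+2 - Z i + (Z i.+3 - Z i.+1 - (Z i.+2 - Z i)));
    last by ring.
  apply: (Rle_trans _ _ _ N); apply: Req_le; congr (_ ^ _); ring.
have hq1 : 3 / 4 <= q 1 by lra.
split=> //; try lra.
by apply: (speed i.+1) => //; lra.
Qed.

Lemma inward_progress j : (j.*2 <= K)%N -> X j.*2 <= rho0 - 9 / 10 * INR j.
Proof.
elim: j => [|j IH] hj; first by rewrite rx0 /=; lra.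
rewrite doubleS in hj *.
have [_ _ _ _ h] := inward_invariant hj.
have := IH (ltnW (ltnW hj)); rewrite S_INR; lra.
Qed.

End Inward.

(** * Reaching the axis exactly *)

Lemma rx_upper y i : 0 <= 3 / 4 - y ^ 2 -> rx i y <= rho0 + INR i./2.
Proof.
move=> hy; suff : rx i y <= rho0 + INR i./2 /\ rx i.+1 y <= rho0 + INR i.+1./2 by case.
elim: i => [|i [h1 h2]].
  by split; [rewrite rx0 /=; lra | have := rx1_le y; rewrite /=; lra].
split=> //; rewrite (_ : i.+2./2 = (i./2).+1) // S_INR.
have [h _] := rows_step i hy.
have := pow2_ge_0 (rz i.+2 y - rz i y).
have := @abs_le_of_sqr (rx i.+2 y - rx i y) 1; lra.
Qed.

(** Steps over two rows have length at most 1 even when clipped, so radii can be bounded by counting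
    back from the axis as well as forward from the polygon. *)
Lemma rx_backward y S k : 0 <= 3 / 4 - y ^ 2 -> rx S y = 0 -> (k <= S)%N ->
  rx (S - k) y <= INR (uphalf k).
Proof.
move=> hy hS; suff : ((k <= S)%N -> rx (S - k) y <= INR (uphalf k)) /\
  ((k.+1 <= S)%N -> rx (S - k.+1) y <= INR (uphalf k.+1)) by case.
elim: k => [|k [h1 h2]].
  split=> hk; first by rewrite subn0 hS /=; lra.
  have := rows_unit (S - 1) hy; rewrite /unit_cross.
  rewrite (_ : (S - 1).+1 = S); last by rewrite subn1 prednK.
  rewrite hS => h; have := pow2_ge_0 (rz (S - 1) y - rz S y).
  have := @abs_le_of_sqr (rx (S - 1) y) 1; rewrite /=; lra.
split=> // hk; rewrite (_ : uphalf k.+2 = (uphalf k).+1) // S_INR.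
have [h _] := rows_step (S - k.+2) hy.
have e : (S - k.+2).+2 = (S - k)%N by rewrite -addn2 -subnA ?subSS ?subn0 //; lia.
rewrite e in h; have := h1 (ltnW (ltnW hk)).
have := pow2_ge_0 (rz (S - k) y - rz (S - k.+2) y).
have := @abs_le_of_sqr (rx (S - k) y - rx (S - k.+2) y) 1; lra.
Qed.

Lemma first_hit (P : nat -> Prop) n : P n ->
  exists m, [/\ (m <= n)%N, P m & forall k, (k < m)%N -> ~ P k].
Proof.
elim: n {-2}n (leqnn n) => [|N IH] n hn hP.
  by exists n; split=> // k; move: hn; rewrite leqn0 => /eqP ->.
case: (classic (exists k, (k < n)%N /\ P k)) => [[k [hk hPk]]|h].
  have [|m [h1 h2 h3]] := IH k _ hPk; first by exact: leq_trans hk hn.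
  by exists m; split=> //; apply: leq_trans h1 (ltnW hk).
by exists n; split=> // k hk hPk; apply: h; exists k.
Qed.

Lemma inward_hits : exists J k, [/\ INR J <= 22 / 10 * rho0, (k <= J.*2)%N & rx k y_in <= 0].
Proof.
have r1 := rho0_gt1.
(* [J] is the integer just above [rho0 / (9 / 10)]; since [rho0 > 1], it is at most
   [(10/9 + 1) * rho0]. *)
have [hu1 hu2] := archimed (rho0 / (9 / 10)).
have hup : (0 <= up (rho0 / (9 / 10)))%Z.
  by apply: le_IZR; lra.
have [J hJ] := IZN _ hup.
rewrite hJ -INR_IZR_INZ in hu1 hu2.
exists J.
case: (classic (exists k, (k <= J.*2)%N /\ rx k y_in <= 0)) => [[k [h1 h2]]|h].
  by exists k; split=> //; lra.
exists J.*2; split=> //; first lra.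
have pos k : (k <= J.*2)%N -> 0 < rx k y_in.
  by move=> hk; apply: Rnot_le_lt => hx; apply: h; exists k.
have := inward_progress pos (leqnn _); lra.
Qed.

Lemma steep_profile : exists S y,
  [/\ (1 < S)%N, rx S y = 0, forall i, unit_cross (rx i y) (rz i y) (rx i.+1 y) (rz i.+1 y)
    & forall i, (i.+2 <= S)%N -> (rx i.+2 y - rx i y) ^ 2 + (rz i.+2 y - rz i y) ^ 2 = 1].
Proof.
have [J [k0 [hJ hk0 hx0]]] := inward_hits.
have [hy1 hy2 _ _] := y_in_facts.
have rng y : y_in <= y <= / 2 -> 0 < 3 / 4 - y ^ 2.
  by move=> [a b]; case: (Rle_lt_dec 0 y) => h; nra.
(* Taking the first row that some [y] brings to the axis keeps all earlier rows positive on the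
   whole parameter interval. *)
pose P i := exists y, y_in <= y <= / 2 /\ rx i y <= 0.
have [|S [hS [y0 [hy0 hx]] hmin]] := @first_hit P k0.
  by exists y_in; split=> //; lra.
have pos i y : (i < S)%N -> y_in <= y <= / 2 -> 0 < rx i y.
  by move=> hi hy; apply: Rnot_le_lt => h; apply: (hmin i hi); exists y.
have S2 : (1 < S)%N.
  move: hx; case: (S) => [|[|//]]; first by rewrite rx0; have := rho0_gt0; lra.
  by have := rx1_gt0 y0; lra.
have [y [hy hxy]] : exists y, y_in <= y <= / 2 /\ rx S y = 0.
  case: (Req_dec (rx S y0) 0) => [h|h]; first by exists y0.
  have hlt : y0 < / 2.
    case: (Req_dec y0 (/ 2)) => [e|e]; last lra.
    by move: hx; rewrite e; have := rx_vertical_gt0 S; lra.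
  have [||||z [hz hz0]] := @IVT_interv (rx S) y0 (/ 2).
  - move=> a ha; have ra : 0 < 3 / 4 - a ^ 2 by apply: rng; lra.
    by case: (rows_continuous S ra).
  - exact: hlt.
  - lra.
  - exact: rx_vertical_gt0.
  by exists z; split=> //; lra.
have hyk := Rlt_le _ _ (rng _ hy).
exists S, y; split=> //; first by move=> i; exact: rows_unit.
move=> i hi; have [_ h] := rows_step i hyk; apply: h.
have hp : 0 <= rx i.+1 y.
  move: hi; rewrite leq_eqVlt => /orP [/eqP e|hi].
    by rewrite -e in hxy; have := pos i.+1 y; rewrite -e ltnSn => /(_ isT hy); lra.
  by apply: Rlt_le; apply: pos => //; exact: ltnW.
(* Adding the bounds from both ends gives [2 * rx i.+1 y <= rho0 + J <= 3.2 * rho0], so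
   [s * rx i.+1 y <= 0.8]. As 0.64 is below 3/4, no clipping occurs. *)
have u1 := rx_upper i.+1 hyk.
have u2 := @rx_backward y S (S - i.+1) hyk hxy (leq_subr _ _).
rewrite subKn in u2; last exact: ltnW.
have u3 : (i.+1./2 + uphalf (S - i.+1) <= J)%N by lia.
have u4 : INR i.+1./2 + INR (uphalf (S - i.+1)) <= INR J.
  by rewrite -plus_INR; apply: le_INR; apply/leP.
have u5 : s * rx i.+1 y <= 8 / 10.
  have : rx i.+1 y <= 16 / 10 * rho0 by lra.
  by have := rho0E; nra.
rewrite (_ : s ^ 2 * rx i.+1 y ^ 2 = (s * rx i.+1 y) ^ 2); last by ring.
have : 0 <= s * rx i.+1 y by nra.
nra.
Qed.
End Profile.

(** * Profiles for all angles *)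

Section ProfileExists.
Local Open Scope R_scope.

Lemma profile_exists (s c : R) : 0 < s -> 0 < c -> s ^ 2 + c ^ 2 = 1 ->
  exists (S : nat) (x z : nat -> R),
  [/\ (0 < S)%N, x 0%N = / (2 * s) /\ z 0%N = 0, x S = 0,
      forall i, (i < S)%N -> unit_cross c (x i) (z i) (x i.+1) (z i.+1)
    & forall i, (i.+2 <= S)%N -> (x i.+2 - x i) ^ 2 + (z i.+2 - z i) ^ 2 = 1].
Proof.
move=> s0 c0 sc1.
case: (Rlt_le_dec (3 * s ^ 2) (c ^ 2)) => hsc.
  have [S [y [h1 h2 h3 h4]]] := steep_profile s0 c0 sc1 hsc.
  by exists S, (fun i => rx s c i y), (fun i => rz s c i y); split=> //; exact: ltnW.
(* Here [s >= / 2], so the circumradius is at most 1 and a pyramid with unit lateral edges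
   suffices. *)
exists 1%N, (fun i => if i is 0%N then / (2 * s) else 0),
  (fun i => if i is 0%N then 0 else sqrt (1 - (/ (2 * s)) ^ 2)).
split=> //; case=> //= _; rewrite /unit_cross.
have h : 0 <= 1 - (/ (2 * s)) ^ 2.
  have e := rho0E s0; have := rho0_gt0 s0; rewrite /rho0 in e *; move: e.
  set r := / (2 * s) => e r0; have : (s * r) ^ 2 = / 4 by rewrite e; field.
  rewrite (_ : (s * r) ^ 2 = s ^ 2 * r ^ 2); last by ring.
  by have := pow2_ge_0 r; nra.
have := sqrt_sqrt _ h; set t := sqrt _; nra.
Qed.
End ProfileExists.

(** * Triangulated discs *)

(** All six orderings are listed, so that a complex is a symmetric ternary relation on natural
    numbers, in which vertices keep their names when others are added. *)
Definition tri3 (p q t u v w : nat) : Prop :=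
  (u = p /\ v = q /\ w = t) \/ (u = p /\ v = t /\ w = q) \/
  (u = q /\ v = p /\ w = t) \/ (u = q /\ v = t /\ w = p) \/
  (u = t /\ v = p /\ w = q) \/ (u = t /\ v = q /\ w = p).

Ltac tri3_cases H :=
  let e1 := fresh in let e2 := fresh in let e3 := fresh in
  destruct H as [(e1 & e2 & e3)|[(e1 & e2 & e3)|[(e1 & e2 & e3)|
    [(e1 & e2 & e3)|[(e1 & e2 & e3)|(e1 & e2 & e3)]]]]]; subst.

Lemma tri3_swap p q t u v w : tri3 p q t u v w -> tri3 p q t v u w.
Proof. by move=> H; tri3_cases H; rewrite /tri3; tauto. Qed.

Lemma tri3_rot p q t u v w : tri3 p q t u v w -> tri3 p q t v w u.
Proof. by move=> H; tri3_cases H; rewrite /tri3; tauto. Qed.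

Lemma tri3_neq p q t u v w :
  [/\ p <> q, p <> t & q <> t] -> tri3 p q t u v w -> u <> v.
Proof. by case=> h1 h2 h3 H; tri3_cases H; auto. Qed.

Lemma tri3_third p q t u v x y :
  [/\ p <> q, p <> t & q <> t] -> tri3 p q t u v x -> tri3 p q t u v y -> x = y.
Proof. by case=> h1 h2 h3 H K; tri3_cases H; tri3_cases K; congruence. Qed.

(** * Surfaces and the gluing of one triangle *)

Section Surfaces.
Implicit Types (L : nat -> nat -> nat -> Prop) (m : nat) (s bs : seq nat).

Definition free_pair L u v := forall x, ~ L u v x.
Definition border L u v := exists x, L u v x /\ forall y, L u v y -> y = x.
Definition joined L u v := exists x, L u v x.

(** [sf_two] says by pigeonhole that an edge lies in at most two triangles; [sf_link] is
    connectedness of vertex links. *)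
Record surface m L : Prop := Surface {
  sf_swap : forall u v w, L u v w -> L v u w;
  sf_rot : forall u v w, L u v w -> L v w u;
  sf_lt : forall u v w, L u v w -> u < m;
  sf_neq : forall u v w, L u v w -> u <> v;
  sf_cover : forall v, v < m -> exists u w, L v u w;
  sf_conn : forall u v, u < m -> v < m -> clos_refl_trans _ (joined L) u v;
  sf_two : forall u v x y z, L u v x -> L u v y -> L u v z -> [\/ x = y, x = z | y = z];
  sf_link : forall v u w, joined L v u -> joined L v w -> clos_refl_trans _ (L v) u w }.

Lemma clos_rt_mono (A : Type) (P Q : A -> A -> Prop) u v :
  (forall x y, P x y -> Q x y) -> clos_refl_trans _ P u v -> clos_refl_trans _ Q u v.
Proof.
move=> PQ; elim=> [x y /PQ h|x|x y z _ h1 _ h2]; [exact: rt_step | exact: rt_refl |].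
exact: rt_trans h1 h2.
Qed.

Lemma clos_rt_sym (A : Type) (P : A -> A -> Prop) u v :
  (forall x y, P x y -> P y x) -> clos_refl_trans _ P u v -> clos_refl_trans _ P v u.
Proof.
move=> PP; elim=> [x y /PP h|x|x y z _ h1 _ h2]; [exact: rt_step | exact: rt_refl |].
exact: rt_trans h2 h1.
Qed.

Definition add_tri L p q t : nat -> nat -> nat -> Prop :=
  fun u v w => L u v w \/ tri3 p q t u v w.

Section AddTriangle.
Variables (m m' : nat) (L : nat -> nat -> nat -> Prop) (p q t : nat).
Hypothesis sL : surface m L.
Hypothesis mm' : m <= m'.
Hypothesis pqt : [/\ p <> q, p <> t & q <> t].
Hypothesis lt_m' : [/\ p < m, q < m' & t < m'].
Hypothesis new_lt : forall v, v < m' -> v < m \/ v = q \/ v = t.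
Hypothesis edges_ok : forall u v w, tri3 p q t u v w -> free_pair L u v \/ border L u v.
(* no pinching: the new triangle meets the old link of each of its vertices in
   an edge, or the vertex is new *)
Hypothesis link_ok : forall u v w, tri3 p q t u v w ->
  (forall x, ~ joined L u x) \/ joined L u v \/ joined L u w.

Hypothesis new_tri : ~ L p q t.

Let L' := add_tri L p q t.

Lemma tri3_new u v w : tri3 p q t u v w -> ~ L u v w.
Proof.
have sw := sf_swap sL; have ro := sf_rot sL.
by move=> H hL; apply: new_tri; tri3_cases H; auto.
Qed.

Lemma add_tri_joined_sym u v : joined L' u v -> joined L' v u.
Proof. by case=> x [/(sf_swap sL)|/tri3_swap] h; exists x; [left|right]. Qed.

(** An edge of the new triangle had at most one coface, so it gets at most two. The link of each
    corner gains the opposite edge, which by [link_ok] either touches the old link or is the whole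
    link. *)
Lemma add_tri_surface : surface m' L'.
Proof.
case: lt_m' => p_m q_m' t_m'.
have jj u v : joined L u v -> joined L' u v by case=> x h; exists x; left.
split.
- by move=> u v w [/(sf_swap sL)|/tri3_swap]; [left|right].
- by move=> u v w [/(sf_rot sL)|/tri3_rot]; [left|right].
- move=> u v w [/(sf_lt sL) h|H]; first exact: leq_trans h mm'.
  by tri3_cases H => //; exact: leq_trans p_m mm'.
- by move=> u v w [/(sf_neq sL)|/(tri3_neq pqt)].
- move=> v /new_lt [/(sf_cover sL) [u [w h]]|[->|->]]; first by exists u, w; left.
    by exists p, t; right; rewrite /tri3; tauto.
  by exists p, q; right; rewrite /tri3; tauto.
- suff H u : u < m' -> clos_refl_trans _ (joined L') p u.
    move=> u v hu hv; apply: rt_trans (H _ hv).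
    by apply: clos_rt_sym (H _ hu); exact: add_tri_joined_sym.
  case/new_lt => [hu|[->|->]].
  + by apply: clos_rt_mono (sf_conn sL p_m hu).
  + by apply: rt_step; exists t; right; rewrite /tri3; tauto.
  + by apply: rt_step; exists q; right; rewrite /tri3; tauto.
- have mix u v x y z : L u v x -> L u v y -> tri3 p q t u v z -> x = y.
    move=> hx hy /edges_ok [/(_ _ hx) //|[w [_ hw]]].
    by rewrite (hw _ hx) (hw _ hy).
  move=> u v x y z [hx|hx] [hy|hy] [hz|hz].
  + exact: (sf_two sL hx hy hz).
  + by apply: Or31; exact: (mix _ _ _ _ _ hx hy hz).
  + by apply: Or32; exact: (mix _ _ _ _ _ hx hz hy).
  + by apply: Or33; exact: tri3_third pqt hy hz.
  + by apply: Or33; exact: (mix _ _ _ _ _ hy hz hx).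
  + by apply: Or32; exact: tri3_third pqt hx hz.
  + by apply: Or31; exact: tri3_third pqt hx hy.
  + by apply: Or31; exact: tri3_third pqt hx hy.
- have L'sym v u w : L' v u w -> L' v w u.
    case=> [h|h]; [left | right].
      exact: (sf_rot sL (sf_swap sL h)).
    exact: (tri3_rot (tri3_swap h)).
  have lk v u w : joined L v u -> joined L v w -> clos_refl_trans _ (L' v) u w.
    by move=> hu hw; apply: clos_rt_mono (sf_link sL hu hw) => x y h; left.
  have toold v u x w y : tri3 p q t v u x -> L v w y -> clos_refl_trans _ (L' v) u w.
    move=> N h; case: (link_ok N) => [/(_ w) []|[h'|h']]; first by exists y.
      by apply: lk => //; exists y.
    apply: (@rt_trans _ _ _ x); first by apply: rt_step; right.
    by apply: lk => //; exists y.
  move=> v u w [x [hx|hx]] [y [hy|hy]].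
  + by apply: lk; [exists x | exists y].
  + apply: clos_rt_sym (toold _ _ _ _ _ hy hx); exact: L'sym.
  + exact: toold hx hy.
  + have [->|->] : w = u \/ w = x.
      by case: pqt => h1 h2 h3; tri3_cases hx; tri3_cases hy; auto; congruence.
    * exact: rt_refl.
    * by apply: rt_step; right.
Qed.

(** Cofaces are counted: an edge of the new triangle gains one, which must be its only one; every
    other pair keeps its cofaces. *)
Lemma add_tri_border u v : border L' u v <->
  (border L u v /\ ~ joined (tri3 p q t) u v) \/ (joined (tri3 p q t) u v /\ free_pair L u v).
Proof.
split.
  case=> x [[hx|hx] hu].
    left; split; first by exists x; split=> // y hy; apply: hu; left.
    case=> y hy; have e := hu y (or_intror hy); subst y.
    exact: tri3_new hy hx.
  right; split; first by exists x.
  move=> y hy; have e := hu y (or_introl hy); subst y.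
  exact: tri3_new hx hy.
case=> [[[x [hx hu]] hn]|[[x hx] hf]].
  exists x; split; first by left.
  by move=> y [/hu //|h]; case: hn; exists y.
exists x; split; first by right.
by move=> y [/hf //|h]; apply: tri3_third pqt h hx.
Qed.
End AddTriangle.
End Surfaces.

(** * Cyclic boundary sequences and discs *)

Fixpoint pairs (x : nat) (s : seq nat) (z : nat) : seq (nat * nat) :=
  if s is y :: s' then (x, y) :: pairs y s' z else [:: (x, z)].
Definition cycpairs (bs : seq nat) := if bs is x :: s then pairs x s x else [::].
Definition consecutive bs u v := (u, v) \in cycpairs bs \/ (v, u) \in cycpairs bs.

Lemma mem_pairs x s z u v : (u, v) \in pairs x s z -> u \in x :: s /\ v \in rcons s z.
Proof.
elim: s x => [|y s IH] x /=.
  by rewrite inE => /eqP [-> ->]; rewrite !inE !eqxx.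
rewrite inE => /orP [/eqP [-> ->]|/IH [h1 h2]]; first by rewrite !inE !eqxx.
by rewrite inE h1 orbT inE h2 orbT.
Qed.

Lemma pairs_rcons x s y z : pairs x (rcons s y) z = rcons (pairs x s y) (y, z).
Proof. by elim: s x => [|w s IH] x //=; rewrite IH. Qed.

Lemma consecutive_rot a s u v : consecutive (a :: s) u v <-> consecutive (rcons s a) u v.
Proof.
case: s => [|b s] //=; rewrite /consecutive /= pairs_rcons.
by rewrite !mem_rcons !inE.
Qed.

(** With [pairs_front]: in a cycle [z, x, s] of length at least 3, the edge between [z] and [x] is
    met once, so neither orientation of it remains among the other pairs. *)
Lemma pairs_back x s z : s != [::] -> uniq (z :: x :: s) -> (x, z) \notin pairs x s z.
Proof.
case: s => //= y s _ /and3P [h1 h2 _]; apply/negP; rewrite inE => /orP [/eqP [e]|].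
  by move: h1; rewrite e !inE eqxx !orbT.
by case/mem_pairs => h _; rewrite h in h2.
Qed.

Lemma pairs_front x s z : uniq (z :: x :: s) -> (z, x) \notin pairs x s z.
Proof. by move=> /= /andP [h _]; apply/negP => /mem_pairs [h' _]; rewrite h' in h. Qed.

Section Discs.
Implicit Types (L : nat -> nat -> nat -> Prop) (m : nat) (s bs : seq nat).

Record disc m L bs : Prop := Disc {
  dc_surf : surface m L;
  dc_uniq : uniq bs;
  dc_size : 2 < size bs;
  dc_border : forall u v, border L u v <-> consecutive bs u v }.

Definition chordless L bs :=
  forall u v, u \in bs -> v \in bs -> joined L u v -> consecutive bs u v.

Lemma disc_rot m L a s : disc m L (a :: s) -> disc m L (rcons s a).
Proof.
case=> h1 h2 h3 h4; split=> //.
- by rewrite rcons_uniq.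
- by rewrite size_rcons.
- by move=> u v; rewrite h4; exact: consecutive_rot.
Qed.

Lemma disc_unrot m L a s : disc m L (rcons s a) -> disc m L (a :: s).
Proof.
case=> h1 h2 h3 h4; split=> //.
- by move: h2; rewrite rcons_uniq.
- by move: h3; rewrite size_rcons.
- by move=> u v; rewrite h4 consecutive_rot.
Qed.

Lemma chordless_rot L a s : chordless L (a :: s) -> chordless L (rcons s a).
Proof.
move=> h u v; rewrite !mem_rcons => hu hv hL.
by apply/consecutive_rot; exact: h.
Qed.

Lemma border_sym m L u v : surface m L -> border L u v -> border L v u.
Proof.
move=> sL [x [h1 h2]]; exists x; split; first exact: (sf_swap sL h1).
by move=> y /(sf_swap sL); exact: h2.
Qed.

Lemma disc_edge m L a b s : disc m L (a :: b :: s) -> border L a b.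
Proof. by move=> d; apply/(dc_border d); left; rewrite /= inE eqxx. Qed.

Lemma disc_lt m L bs u : disc m L bs -> u \in bs -> u < m.
Proof.
move=> d hu; suff [v hv] : exists v, (u, v) \in cycpairs bs.
  have [x [h _]] : border L u v by apply/(dc_border d); left.
  exact: (sf_lt (dc_surf d) h).
case: bs hu {d} => [|x t] //=.
move: {3}x => z; elim: t x => [|y t IH] x /=.
  by rewrite inE => /eqP ->; exists z; rewrite inE.
rewrite inE => /orP [/eqP ->|]; first by exists y; rewrite inE eqxx.
by case/IH => v hv; exists v; rewrite inE hv orbT.
Qed.

(** The fresh vertex is [m]. An ear turns the edge from [a] to [b] into a chord, so chordlessness
    has to be restored by a later gluing. *)
Lemma disc_ear m L a b s : disc m L (a :: b :: s) ->
  disc m.+1 (add_tri L a b m) (a :: m :: b :: s).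
Proof.
move=> d; have sL := dc_surf d.
have bab := disc_edge d; have bba := border_sym sL bab.
have lt_bs u : u \in a :: b :: s -> u < m := @disc_lt _ _ _ u d.
have am : a < m by apply: lt_bs; rewrite inE eqxx.
have bm : b < m by apply: lt_bs; rewrite !inE eqxx orbT.
have jab : joined L a b by case: bab => x [h _]; exists x.
have jba : joined L b a by case: bba => x [h _]; exists x.
have us := dc_uniq d.
have ab : a <> b by move=> e; move: us; rewrite e /= inE eqxx.
have s0 : s != [::] by case: (s) (dc_size d).
have frm v : free_pair L m v by move=> x /(sf_lt sL); rewrite ltnn.
have frm' v : free_pair L v m by move=> x /(sf_swap sL); exact: frm.
have neqs : [/\ a <> b, a <> m & b <> m] by split=> // e; move: am bm; rewrite e ltnn.
have edges u v w : tri3 a b m u v w -> free_pair L u v \/ border L u v.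
  by move=> H; tri3_cases H; auto.
have fresh : ~ L a b m by move=> /(sf_rot sL) /(frm' _).
have links u v w : tri3 a b m u v w ->
    (forall x, ~ joined L u x) \/ joined L u v \/ joined L u w.
  by move=> H; tri3_cases H; auto; left=> x [y] /frm.
split.
- apply: (@add_tri_surface m m.+1) => //.
  + by split=> //; exact: ltnW.
  + by move=> v; rewrite ltnS leq_eqVlt => /orP [/eqP|]; auto.
- have mnot : m \notin a :: b :: s by apply/negP => /lt_bs; rewrite ltnn.
  rewrite (perm_uniq (permEl (perm_catCA [:: a] [:: m] (b :: s)))).
  by rewrite cat1s cons_uniq mnot.
- by have := dc_size d => /= h; lia.
have ltP u v : (u, v) \in pairs b s a -> u < m /\ v < m.
  case/mem_pairs => h1 h2; split; apply: lt_bs; first by rewrite inE h1 orbT.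
  by move: h2; rewrite mem_rcons !inE => /orP [->|->]; rewrite ?orbT.
have nP u v : (u, v) \in pairs b s a -> ~ joined (tri3 a b m) u v.
  move=> h [w H]; have [l1 l2] := ltP _ _ h.
  have p1 := pairs_back s0 us; have p2 := pairs_front us.
  by tri3_cases H; rewrite ?ltnn // in l1 l2 p1 p2 *; rewrite h in p1 p2.
have jt u v : joined (tri3 a b m) u v -> joined (tri3 a b m) v u.
  by case=> w /tri3_swap h; exists w.
move=> u v; rewrite (add_tri_border sL neqs fresh); split.
  case=> [[/(dc_border d) h hn]|[[w H] hf]].
    case: h; rewrite /= inE => /orP [/eqP [e1 e2]|h].
    + by subst; case: hn; exists m; rewrite /tri3; tauto.
    + by left; rewrite /= !inE h !orbT.
    + by subst; case: hn; exists m; rewrite /tri3; tauto.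
    + by right; rewrite /= !inE h !orbT.
  have nf x y : border L x y -> free_pair L x y -> False by case=> z [h _] /(_ z).
  tri3_cases H; rewrite /consecutive /= !inE ?eqxx ?orbT; auto.
  - by case: (nf _ _ bab hf).
  - by case: (nf _ _ bba hf).
case; rewrite /= !inE => /or3P [/eqP [e1 e2]|/eqP [e1 e2]|h]; subst.
- by right; split=> //; exists b; rewrite /tri3; tauto.
- by right; split=> //; exists a; rewrite /tri3; tauto.
- left; split; last exact: nP h.
  by apply/(dc_border d); left; rewrite /= inE h orbT.
- by right; split=> //; exists b; rewrite /tri3; tauto.
- by right; split=> //; exists a; rewrite /tri3; tauto.
- left; split; last by move/jt; exact: nP h.
  by apply/(dc_border d); right; rewrite /= inE h orbT.
Qed.

Lemma disc_notch m L a b c s : disc m L (a :: b :: c :: s) -> s != [::] ->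
  free_pair L a c -> disc m (add_tri L a b c) (a :: c :: s).
Proof.
move=> d s0 fac; have sL := dc_surf d.
have bab := disc_edge d; have bba := border_sym sL bab.
have bbc : border L b c by apply/(dc_border d); left; rewrite /= !inE eqxx orbT.
have bcb := border_sym sL bbc.
have lt_bs u : u \in a :: b :: c :: s -> u < m := @disc_lt _ _ _ u d.
have am : a < m by apply: lt_bs; rewrite inE eqxx.
have bm : b < m by apply: lt_bs; rewrite !inE eqxx orbT.
have cm : c < m by apply: lt_bs; rewrite !inE eqxx !orbT.
have jj x y : border L x y -> joined L x y by case=> z [h _]; exists z.
have us := dc_uniq d.
have neqs : [/\ a <> b, a <> c & b <> c].
  by split=> e; move: us; rewrite e /= !inE eqxx ?orbT ?andbF.
have fca : free_pair L c a by move=> x /(sf_swap sL) /fac.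
have edges u v w : tri3 a b c u v w -> free_pair L u v \/ border L u v.
  by move=> H; tri3_cases H; auto.
have fresh : ~ L a b c.
  by move=> /(sf_swap sL) /(sf_rot sL) /fac.
have links u v w : tri3 a b c u v w ->
    (forall x, ~ joined L u x) \/ joined L u v \/ joined L u w.
  by move=> H; right; tri3_cases H; auto.
have us' : uniq (a :: c :: s).
  move: us; rewrite /= !inE !negb_or => /andP [/andP [_ /andP [-> ->]]].
  by case/andP => _ /andP [-> ->].
split=> //.
- apply: (@add_tri_surface m m) => //.
  by auto.
- by move: s0; case: (s).
have ua : (b \notin c :: s) by case/and3P: us.
have ba : b \notin rcons s a.
  rewrite mem_rcons inE negb_or; case: neqs => /eqP h _ _; rewrite eq_sym h /=.
  by move: ua; rewrite inE negb_or => /andP [].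
have nP u v : (u, v) \in pairs c s a -> ~ joined (tri3 a b c) u v.
  move=> h [w H]; have [l1 l2] := mem_pairs h.
  have p1 := pairs_back s0 us'; have p2 := pairs_front us'.
  by tri3_cases H; rewrite ?(negbTE ua) ?(negbTE ba) // in l1 l2; rewrite h in p1 p2.
have jt u v : joined (tri3 a b c) u v -> joined (tri3 a b c) v u.
  by case=> w /tri3_swap h; exists w.
move=> u v; rewrite (add_tri_border sL neqs fresh); split.
  case=> [[/(dc_border d) h hn]|[[w H] hf]].
    case: h; rewrite /= !inE => /or3P [/eqP [e1 e2]|/eqP [e1 e2]|h].
    + by subst; case: hn; exists c; rewrite /tri3; tauto.
    + by subst; case: hn; exists a; rewrite /tri3; tauto.
    + by left; rewrite /= !inE h !orbT.
    + by subst; case: hn; exists c; rewrite /tri3; tauto.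
    + by subst; case: hn; exists a; rewrite /tri3; tauto.
    + by right; rewrite /= !inE h !orbT.
  have nf x y : border L x y -> free_pair L x y -> False by case=> z [h _] /(_ z).
  tri3_cases H; rewrite /consecutive /= !inE ?eqxx ?orbT; auto; by case: (nf _ _ _ hf).
case; rewrite /= !inE => /orP [/eqP [e1 e2]|h]; subst.
- by right; split=> //; exists b; rewrite /tri3; tauto.
- left; split; last exact: nP h.
  by apply/(dc_border d); left; rewrite /= !inE h !orbT.
- by right; split=> //; exists b; rewrite /tri3; tauto.
- left; split; last by move/jt; exact: nP h.
  by apply/(dc_border d); right; rewrite /= !inE h !orbT.
Qed.

(** With at least four boundary vertices, [a] and [c] are not consecutive, so an edge between them
    would be a chord. Afterwards this edge is the only new one, and it lies on the boundary. *)
Lemma chordless_notch m L a b c s : disc m L (a :: b :: c :: s) -> s != [::] ->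
  chordless L (a :: b :: c :: s) ->
  free_pair L a c /\ chordless (add_tri L a b c) (a :: c :: s).
Proof.
move=> d s0 ch; have us := dc_uniq d.
have nb : b \notin a :: c :: s.
  by case/and3P: us; rewrite /= !inE !negb_or => /and3P [h _ _] h' _; rewrite eq_sym h.
have us' : uniq (a :: c :: s).
  move: us; rewrite /= !inE !negb_or => /andP [/andP [_ /andP [-> ->]]].
  by case/andP => _ /andP [-> ->].
have old u v : u \in a :: c :: s -> v \in a :: c :: s -> joined L u v ->
    (u, v) \in pairs c s a \/ (v, u) \in pairs c s a.
  have inb w : w \in a :: c :: s -> w \in a :: b :: c :: s.
    by rewrite !inE => /orP [->|->]; rewrite ?orbT.
  move=> hu hv hL; have := ch _ _ (inb _ hu) (inb _ hv) hL.
  by rewrite /consecutive /= !inE;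
    case=> /or3P [/eqP [e1 e2]|/eqP [e1 e2]|]; auto; subst; rewrite ?hu ?hv in nb.
split.
  move=> x h; have := @old a c; rewrite !inE !eqxx !orbT => /(_ isT isT (ex_intro _ x h)).
  by case=> h'; [have := pairs_front us' | have := pairs_back s0 us']; rewrite h'.
move=> u v hu hv [x [h|H]].
  have := old u v hu hv (ex_intro _ x h).
  by rewrite /consecutive /= !inE => -[->|->]; rewrite ?orbT; auto.
rewrite /consecutive /= !inE.
by tri3_cases H; rewrite ?eqxx; auto; rewrite ?hu ?hv in nb.
Qed.

(** An ear on [a, b] followed by a notch at [b]: the edge from [m] to [c] is new because [m] only
    meets [a] and [b]. The chord left by the ear is harmless since [b] becomes interior. *)
Lemma disc_flip m L a b c s :
  disc m L (a :: b :: c :: s) -> chordless L (a :: b :: c :: s) ->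
  let L' := add_tri (add_tri L a b m) m b c in
  disc m.+1 L' (a :: m :: c :: s) /\ chordless L' (a :: m :: c :: s).
Proof.
move=> d ch L'; have sL := dc_surf d; have us := dc_uniq d.
have lt_bs u : u \in a :: b :: c :: s -> u < m := @disc_lt _ _ _ u d.
have frm v : free_pair L m v by move=> x /(sf_lt sL); rewrite ltnn.
have cm : c < m by apply: lt_bs; rewrite !inE eqxx !orbT.
have nb : b \notin a :: c :: s.
  by case/and3P: us; rewrite /= !inE !negb_or => /and3P [h _ _] h' _; rewrite eq_sym h.
have ac : a <> c by move=> e; move: us; rewrite e /= !inE eqxx ?orbT ?andbF.
have bc : c <> b by move=> e; move: nb; rewrite e !inE eqxx ?orbT.
have d1 := disc_rot (disc_ear d).
split.
  apply: disc_unrot; apply: (disc_notch d1); first by case: (s).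
  move=> x [/frm //|H]; tri3_cases H => //; by rewrite ltnn in cm.
move=> u v hu hv [x H].
have mold w : w \in a :: m :: c :: s -> w < m -> w \in a :: c :: s.
  by rewrite !inE => /or4P [->|/eqP ->|->|->]; rewrite ?ltnn ?orbT.
have um w : w \in a :: m :: c :: s -> w <> b.
  move=> h e; have bm : b < m by apply: lt_bs; rewrite !inE eqxx orbT.
  by rewrite e in h; have := mold b h bm; rewrite (negbTE nb).
case: H => [[h|H]|H].
- have lu := sf_lt sL h; have lv := sf_lt sL (sf_swap sL h).
  have hu' := mold _ hu lu; have hv' := mold _ hv lv.
  have inb w : w \in a :: c :: s -> w \in a :: b :: c :: s.
    by rewrite !inE => /orP [->|->]; rewrite ?orbT.
  have := ch _ _ (inb _ hu') (inb _ hv') (ex_intro _ x h).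
  by rewrite /consecutive /= !inE;
    case=> /or3P [/eqP [e1 e2]|/eqP [e1 e2]|->]; rewrite ?orbT; auto; subst;
    rewrite ?hu' ?hv' in nb.
- rewrite /consecutive /= !inE.
  by tri3_cases H; rewrite ?eqxx; auto; case: (um b).
- rewrite /consecutive /= !inE.
  by tri3_cases H; rewrite ?eqxx ?orbT; auto; case: (um b).
Qed.
End Discs.

(** * Triangles, fans and wheels *)

Lemma triangle_disc : disc 3 (tri3 0 1 2) [:: 0; 1; 2].
Proof.
have d : [/\ 0 <> 1, 0 <> 2 & 1 <> 2] by [].
split=> //.
  split.
  - by move=> u v w; exact: tri3_swap.
  - by move=> u v w; exact: tri3_rot.
  - by move=> u v w H; tri3_cases H.
  - by move=> u v w; exact: tri3_neq.
  - move=> [|[|[|//]]] _; [exists 1, 2 | exists 0, 2 | exists 0, 1]; rewrite /tri3; tauto.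
  - have j u v : u < 3 -> v < 3 -> u <> v -> joined (tri3 0 1 2) u v.
      move: u v => [|[|[|//]]] [|[|[|//]]] // _ _ _;
      [exists 2 | exists 1 | exists 2 | exists 0 | exists 1 | exists 0]; rewrite /tri3; tauto.
    move=> u v hu hv; have [->|/eqP h] := eqVneq u v; first exact: rt_refl.
    by apply: rt_step; exact: j.
  - by move=> u v x y z hx hy _; apply: Or31; exact: tri3_third d hx hy.
  - move=> v u w [x hx] [y hy].
    have [->|->] : w = u \/ w = x by tri3_cases hx; tri3_cases hy; auto.
      exact: rt_refl.
    exact: rt_step.
move=> u v; rewrite /consecutive /= !inE; split.
  by case=> x [H _]; tri3_cases H; auto.
have b x y z : tri3 0 1 2 x y z -> border (tri3 0 1 2) x y.
  by move=> h; exists z; split=> // t ht; exact: tri3_third d ht h.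
by case=> /or3P [] /eqP [-> ->]; apply: b; rewrite /tri3;
  [instantiate (1 := 2) | instantiate (1 := 0) | instantiate (1 := 1) |
   instantiate (1 := 2) | instantiate (1 := 0) | instantiate (1 := 1)]; tauto.
Qed.

(** The hub is 0; each ear is glued on the edge from the last rim vertex to the hub. *)
Lemma fan_disc N : 2 <= N -> exists L, disc N.+1 L (iota 0 N.+1) /\
  (forall u v w, L u v w -> 0 < u -> 0 < v -> v = u.+1 \/ u = v.+1).
Proof.
elim: N => [//|N IH]; rewrite leq_eqVlt => /orP [/eqP [<-]|].
  exists (tri3 0 1 2); split; first exact: triangle_disc.
  by move=> u v w H; tri3_cases H; auto.
rewrite ltnS => hN; have [L [d hL]] := IH hN.
have e k : iota 0 k.+1 = rcons (iota 0 k) k by rewrite -addn1 iotaD cats1.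
exists (add_tri L N 0 N.+1); split.
  have e0 : iota 0 N = 0 :: iota 1 N.-1 by case: (N) hN.
  move: d; rewrite !e e0 => /disc_unrot /disc_ear /disc_rot.
  by rewrite rcons_cons => /disc_rot.
move=> u v w [|H]; first exact: hL.
by tri3_cases H; auto.
Qed.

(** The triangle [N, 0, 1] closes the fan and makes the hub interior, which removes the chords
    through it. *)
Lemma wheel_disc N : 2 < N -> exists L, [/\ disc N.+1 L (iota 1 N), chordless L (iota 1 N)
  & forall u v w, L u v w -> 0 < u -> 0 < v ->
      [\/ v = u.+1, u = v.+1, u = 1 /\ v = N | u = N /\ v = 1]].
Proof.
move=> hN; have [L [d hL]] := fan_disc (ltnW hN).
have e' a k : iota a k.+1 = rcons (iota a k) (a + k) by rewrite -addn1 iotaD cats1.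
have e k : iota 0 k.+1 = rcons (iota 0 k) k := e' 0 k.
have e1 : iota 1 N = rcons (1 :: iota 2 N.-2) N.
  by case: (N) hN => [|[|k]] // _; rewrite e' add1n.
have e0 : iota 0 N = [:: 0, 1 & iota 2 N.-2] by case: (N) hN => [|[|k]].
move: d; rewrite e => /disc_unrot; rewrite e0 => d.
have hL' u v w : add_tri L N 0 1 u v w -> 0 < u -> 0 < v ->
      [\/ v = u.+1, u = v.+1, u = 1 /\ v = N | u = N /\ v = 1].
  move=> [/hL h|H] hu hv; first by case: (h hu hv); [constructor 1 | constructor 2].
  by tri3_cases H => //; [constructor 4 | constructor 3].
exists (add_tri L N 0 1); split=> //.
  rewrite e1; apply: disc_rot; apply: disc_notch d _ _.
    by case: (N) hN => [|[|[|k]]].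
  by move=> x /hL h; case: h; rewrite ?(ltnW (ltnW hN)) //; lia.
have cons u : 0 < u -> u < N -> (u, u.+1) \in cycpairs (iota 1 N).
  have H k a z : a <= u -> u.+1 < a + k.+1 -> (u, u.+1) \in pairs a (iota a.+1 k) z.
    elim: k a => [|k IHk] a h1 h2; first by lia.
    rewrite /= inE; move: h1; rewrite leq_eqVlt => /orP [/eqP ->|h1]; first by rewrite eqxx.
    by rewrite IHk ?orbT //; lia.
  case: (N) => [//|k] h1 h2; rewrite [iota 1 _]/=; apply: H => //; lia.
have lastp : (N, 1) \in cycpairs (iota 1 N).
  rewrite e1 /cycpairs rcons_cons pairs_rcons mem_rcons inE; by rewrite eqxx.
move=> u v; rewrite !mem_iota => hu hv [x /hL' h].
case: h; try lia.
- by move=> e2; left; rewrite e2; apply: cons; lia.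
- by move=> e2; right; rewrite e2; apply: cons; lia.
- by case=> -> ->; right.
- by case=> -> ->; left.
Qed.

(** * Closed curves spanned by chordless discs of unit triangles *)

Section Patches.
Local Open Scope R_scope.
Implicit Types (L : nat -> nat -> nat -> Prop) (g : seq point).

Lemma dist2_sym (p q : point) : dist2 p q = dist2 q p.
Proof.
by case: p => [[x y] z]; case: q => [[x' y'] z']; rewrite /dist2 /pdot /padd /pscale; ring.
Qed.

Definition patched g : Prop := exists m L (f : nat -> point) bs,
  [/\ disc m L bs, chordless L bs, forall u v w, L u v w -> dist2 (f u) (f v) = 1
    & map f bs = g].

Lemma patched_rot a g : patched (a :: g) -> patched (rcons g a).
Proof.
case=> m [L [f [[|b s] [//= d ch un [<- <-]]]]].
exists m, L, f, (rcons s b); split=> //; [exact: disc_rot|exact: chordless_rot|].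
by rewrite map_rcons.
Qed.

Lemma patched_cat g1 g2 : patched (g1 ++ g2) -> patched (g2 ++ g1).
Proof.
elim: g1 g2 => [|a g1 IH] g2; first by rewrite cats0.
by rewrite cat_cons => /patched_rot; rewrite rcons_cat => /IH; rewrite cat_rcons.
Qed.

Lemma patched_flip a b b' c g : patched [:: a, b, c & g] ->
  dist2 a b' = 1 -> dist2 b b' = 1 -> dist2 c b' = 1 -> patched [:: a, b', c & g].
Proof.
case=> m [L [f [[|x [|y [|z s]]] [//= d ch un [<- <- <- <-]]]]] h1 h2 h3.
have [d' ch'] := disc_flip d ch.
(* Old vertices are numbered below [m], so the value at [m] is free for the new point. *)
pose f' v := if v == m then b' else f v.
have f'E v : (v < m)%N -> f' v = f v by move=> h; rewrite /f' ltn_eqF.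
have f'm : f' m = b' by rewrite /f' eqxx.
clearbody f'; rewrite -f'm in h1 h2 h3.
have xm : (x < m)%N by apply: (disc_lt d); rewrite !inE eqxx ?orbT.
have ym : (y < m)%N by apply: (disc_lt d); rewrite !inE eqxx ?orbT.
have zm : (z < m)%N by apply: (disc_lt d); rewrite !inE eqxx ?orbT.
have eab : dist2 (f x) (f y) = 1 by have [t [/un h _]] := disc_edge d.
have ebc : dist2 (f y) (f z) = 1.
  by have := disc_rot d; rewrite rcons_cons => /disc_edge [t [/un h _]].
have [fx fy fz] : [/\ f' x = f x, f' y = f y & f' z = f z] by rewrite !f'E.
exists m.+1, (add_tri (add_tri L x y m) m y z), f', [:: x, m, z & s]; split.
- exact: d'.
- exact: ch'.
- move=> u v w [[h|H]|H].
  + have lu := sf_lt (dc_surf d) h.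
    have lv := sf_lt (dc_surf d) (sf_swap (dc_surf d) h).
    by rewrite !f'E //; apply: un h.
  + by tri3_cases H; rewrite ?fx ?fy ?fz //; rewrite dist2_sym.
  + by tri3_cases H; rewrite ?fx ?fy ?fz //; rewrite dist2_sym.
rewrite /= f'm !f'E //; congr [:: _, _, _ & _]; apply/eq_in_map => v hv.
by apply: f'E; apply: (disc_lt d); rewrite !inE hv !orbT.
Qed.

Lemma patched_notch a b c g : patched [:: a, b, c & g] -> g <> [::] ->
  dist2 a c = 1 -> patched [:: a, c & g].
Proof.
case=> m [L [f [[|x [|y [|z s]]] [//= d ch un [<- _ <- <-]]]]] g0 h1.
have s0 : s != [::] by case: (s) g0.
have [fr ch'] := chordless_notch d s0 ch.
have eab : dist2 (f x) (f y) = 1 by have [t [/un h _]] := disc_edge d.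
have ebc : dist2 (f y) (f z) = 1.
  by have := disc_rot d; rewrite rcons_cons => /disc_edge [t [/un h _]].
exists m, (add_tri L x y z), f, [:: x, z & s]; split=> //; first exact: disc_notch d s0 fr.
by move=> u v w [/un //|H]; tri3_cases H => //; rewrite dist2_sym.
Qed.

(** Points of [g] may repeat: only the abstract rim vertices are distinct. Spikes make use of
    this. *)
Lemma patched_wheel o g : (2 < size g)%N ->
  (forall i, (i < size g)%N -> dist2 o (nth o g i) = 1) ->
  (forall i, (i.+1 < size g)%N -> dist2 (nth o g i) (nth o g i.+1) = 1) ->
  dist2 (last o g) (head o g) = 1 -> patched g.
Proof.
move=> sg hub rim cl; have [L [d ch hL]] := wheel_disc sg.
exists (size g).+1, L, (nth o (o :: g)), (iota 1 (size g)); split=> //; last first.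
  apply: (@eq_from_nth _ o); first by rewrite size_map size_iota.
  by move=> i; rewrite size_map size_iota => hi; rewrite (nth_map 0%N) ?size_iota // nth_iota.
have cl' : dist2 (nth o g (size g).-1) (nth o g 0) = 1 by rewrite nth_last nth0.
move=> u v w h; have sL := dc_surf d.
have lu := sf_lt sL h; have lv := sf_lt sL (sf_swap sL h).
have uv := sf_neq sL h.
case: u v h lu lv uv => [|u] [|v] h lu lv uv //=.
- by apply: hub.
- by rewrite dist2_sym; apply: hub.
have [e|e|[e e']|[e e']] := hL _ _ _ h isT isT.
- by case: e => e; rewrite e; apply: rim; rewrite -e.
- by case: e => e; rewrite e dist2_sym; apply: rim; rewrite -e.
- have ev : v = (size g).-1 by rewrite -e'.
  by case: e => ->; rewrite ev dist2_sym.
- have eu : u = (size g).-1 by rewrite -e.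
  by case: e' => ->; rewrite eu.
Qed.
End Patches.

(** * From relations to finite simplicial complexes *)

Lemma cycpairs_nth bs u v : (u, v) \in cycpairs bs <->
  exists2 i, i < size bs & u = nth 0 bs i /\ v = nth 0 bs (i.+1 %% size bs).
Proof.
case: bs => [|x s] /=; first by split=> // -[].
have H : forall y t z, (u, v) \in pairs y t z <->
    exists2 i, i < (size t).+1 & u = nth 0 (y :: t) i /\ v = nth 0 (rcons t z) i.
  move=> y t z; elim: t y => [|y' t IH] y /=.
    rewrite inE; split; first by move/eqP => [-> ->]; exists 0.
    by case=> -[|//] _ [/= -> ->].
  rewrite inE; split.
    case/orP => [/eqP [-> ->]|/IH [i hi [h1 h2]]]; first by exists 0.
    by exists i.+1.
  case=> -[_ [/= -> ->]|i hi [/= h1 h2]]; first by rewrite eqxx.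
  by apply/orP; right; apply/IH; exists i.
rewrite H; split=> -[i hi [h1 h2]]; exists i => //; split=> //; move: h2;
  rewrite nth_rcons; move: hi; rewrite ltnS leq_eqVlt => /orP [/eqP ->|hi].
- by rewrite ltnn eqxx modnn.
- by rewrite hi modn_small.
- by rewrite ltnn eqxx modnn.
- by rewrite hi modn_small.
Qed.

Section ToDome.
Variables (m : nat) (L : nat -> nat -> nat -> Prop).
Hypothesis sL : surface m L.

(** Excluded middle turns the propositional relation [L] into a finite set. *)
Definition triangles : {set {set 'I_m}} :=
  [set t | if excluded_middle_informative
     (exists x y z : 'I_m, t = [set x; y; z] /\ L x y z) then true else false].

Lemma trianglesP t : reflect (exists x y z : 'I_m, t = [set x; y; z] /\ L x y z)
  (t \in triangles).
Proof. by rewrite inE; case: excluded_middle_informative => h; constructor. Qed.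

Lemma mem_triangles (x y z : 'I_m) : L x y z -> [set x; y; z] \in triangles.
Proof. by move=> h; apply/trianglesP; exists x, y, z. Qed.

Lemma triangle_third t (u v : 'I_m) : t \in triangles -> u \in t -> v \in t -> u != v ->
  exists w : 'I_m, t = [set u; v; w] /\ L u v w.
Proof.
have sw := sf_swap sL; have ro := sf_rot sL.
case/trianglesP => x [y [z [-> h]]]; rewrite !inE => hu hv huv.
have p1 : [set x; y; z] = [set y; x; z] by rewrite [[set y; x]]setUC.
have p2 : [set x; y; z] = [set x; z; y] by rewrite setUAC.
have p3 : [set x; y; z] = [set z; x; y] by rewrite p2 [[set z; x]]setUC.
have p4 : [set x; y; z] = [set y; z; x] by rewrite p1 setUAC.
have p5 : [set x; y; z] = [set z; y; x] by rewrite p3 setUAC.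
by case/orP: hu => [/orP [/eqP eu|/eqP eu]|/eqP eu];
   case/orP: hv => [/orP [/eqP ev|/eqP ev]|/eqP ev]; subst;
   rewrite ?eqxx in huv => //;
   [exists z | exists y | exists z | exists x | exists y | exists x]; split; auto.
Qed.

Lemma card_triangle (x y z : 'I_m) : L x y z -> #|[set x; y; z]| = 3.
Proof.
move=> h; have n1 := sf_neq sL h; have n2 := sf_neq sL (sf_rot sL h).
have n3 := sf_neq sL (sf_rot sL (sf_rot sL h)).
rewrite setUC cardsU1 cards2 !inE.
have -> : (z == x) = false by apply/eqP => e; apply: n3; rewrite e.
have -> : (z == y) = false by apply/eqP => e; apply: n2; rewrite e.
by have -> : (x == y) = false by apply/eqP => e; apply: n1; rewrite e.
Qed.

Lemma is_edgeP (u v : 'I_m) : reflect (joined L u v) (is_edge triangles [set u; v]).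
Proof.
apply: (iffP andP) => [[]|[w h]].
  rewrite cards2 => h2 /existsP [t /andP [ht /subsetP s]].
  have huv : u != v by move: h2; case: (u != v).
  have [||w [_ h]] := triangle_third ht _ _ huv.
  - by apply: s; rewrite !inE eqxx.
  - by apply: s; rewrite !inE eqxx orbT.
  by exists w.
have huv : u != v by apply/eqP => e; apply: (sf_neq sL h); rewrite e.
rewrite cards2 huv; split=> //.
have hw : w < m by exact: (sf_lt sL (sf_rot sL (sf_rot sL h))).
apply/existsP; exists [set u; v; Ordinal hw]; rewrite mem_triangles //=.
by exact: subsetUl.
Qed.

Lemma mem_cofaces (u v : 'I_m) t : u != v ->
  t \in [set t in triangles | [set u; v] \subset t] ->
  exists w : 'I_m, t = [set u; v; w] /\ L u v w.
Proof.
move=> huv; rewrite inE => /andP [ht /subsetP s].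
by apply: triangle_third; rewrite ?s // !inE eqxx ?orbT.
Qed.

Lemma ntri_le2 (u v : 'I_m) : u != v -> ntri triangles [set u; v] <= 2.
Proof.
move=> huv; rewrite leqNgt; apply/negP => /card_gt2P [x [y [z [[hx hy hz] [n1 n2 n3]]]]].
have [x' [ex lx]] := mem_cofaces huv hx.
have [y' [ey ly]] := mem_cofaces huv hy.
have [z' [ez lz]] := mem_cofaces huv hz.
case: (sf_two sL lx ly lz) => /val_inj e.
- by move: n1; rewrite ex ey e eqxx.
- by move: n3; rewrite ex ez e eqxx.
- by move: n2; rewrite ey ez e eqxx.
Qed.

Lemma is_bedgeP (u v : 'I_m) : reflect (border L u v) (is_bedge triangles [set u; v]).
Proof.
apply: (iffP andP) => [[/is_edgeP [w0 h0] /cards1P [t et]]|[w [h hu]]].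
  have huv : u != v by apply/eqP => e; apply: (sf_neq sL h0); rewrite e.
  have cof (w : 'I_m) : L u v w -> [set u; v; w] = t.
    move=> h; apply/set1P; rewrite -et inE mem_triangles //=.
    by exact: subsetUl.
  have hw0 : w0 < m by exact: (sf_lt sL (sf_rot sL (sf_rot sL h0))).
  exists w0; split=> // y hy.
  have hym : y < m by exact: (sf_lt sL (sf_rot sL (sf_rot sL hy))).
  have e1 := cof (Ordinal hw0) h0; have e2 := cof (Ordinal hym) hy.
  have : Ordinal hym \in [set u; v; Ordinal hw0] by rewrite e1 -e2 !inE eqxx orbT.
  rewrite !inE => /orP [/orP [/eqP e|/eqP e]|/eqP [] //].
    by case: (sf_neq sL (sf_rot sL (sf_rot sL hy))); rewrite -e.
  by case: (sf_neq sL (sf_rot sL hy)); rewrite -e.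
have huv : u != v by apply/eqP => e; apply: (sf_neq sL h); rewrite e.
have hw : w < m by exact: (sf_lt sL (sf_rot sL (sf_rot sL h))).
split; first by apply/is_edgeP; exists w.
apply/cards1P; exists [set u; v; Ordinal hw]; apply/setP => t; rewrite in_set1.
apply/idP/eqP => [/(mem_cofaces huv) [w' [-> /hu e]]|->].
  by congr (_ :|: [set _]); apply: val_inj.
by rewrite inE mem_triangles //=; exact: subsetUl.
Qed.

Lemma surface_complex : 0 < m -> is_surface_complex triangles.
Proof.
move=> m0; have sw := sf_swap sL; have ro := sf_rot sL; have lt := sf_lt sL.
(* A retraction of the natural numbers onto the vertices carries paths over to [connect]; edges only
   involve numbers below [m], where it is the identity. *)
pose o (x : nat) : 'I_m := insubd (Ordinal m0) x.
have oE x : x < m -> o x = x :> nat by move=> h; rewrite /o insubdK.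
have ov (x : 'I_m) : o x = x by apply: val_inj; rewrite /= oE.
have cover (v : 'I_m) : exists2 t, t \in triangles & v \in t.
  have [u [w h]] := sf_cover sL (ltn_ord v).
  have hu := lt _ _ _ (sw _ _ _ h); have hw := lt _ _ _ (ro _ _ _ (ro _ _ _ h)).
  exists [set v; Ordinal hu; Ordinal hw]; first exact: mem_triangles.
  by rewrite !inE eqxx.
split.
  by have [t ht _] := cover (Ordinal m0); apply/set0Pn; exists t.
split=> //.
- by move=> t /trianglesP [x [y [z [-> /card_triangle]]]].
- move=> u v; have := sf_conn sL (ltn_ord u) (ltn_ord v).
  suff H x y : clos_refl_trans _ (joined L) x y -> connect (adj triangles) (o x) (o y).
    by move/H; rewrite !ov.
  elim=> [a b h|a|a b c' _ h1 _ h2]; [|exact: connect0|exact: connect_trans h1 h2].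
  apply: connect1; apply/is_edgeP; case: h => w h.
  by exists w; rewrite !oE //; [apply: lt (sw _ _ _ h) | apply: lt h].
- move=> e he; have /andP [/cards2P [u [v [huv ->]]] _] := he.
  exact: ntri_le2.
- move=> v u w; rewrite setUC => /is_edgeP h1; rewrite setUC => /is_edgeP h2.
  have := sf_link sL h1 h2.
  suff H x y : clos_refl_trans _ (L v) x y -> connect (link_rel triangles v) (o x) (o y).
    by move/H; rewrite !ov.
  elim=> [a b h|a|a b c' _ h3 _ h4]; [|exact: connect0|exact: connect_trans h3 h4].
  apply: connect1; apply: mem_triangles.
  rewrite !oE; first exact: sw.
    exact: lt (ro _ _ _ (ro _ _ _ h)).
  exact: lt (sw _ _ _ h).
Qed.
End ToDome.

Lemma patched_domed g : patched g -> can_be_domed g.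
Proof.
case=> m [L [f [bs [d ch un <-]]]]; have sL := dc_surf d.
have szE : size (map f bs) = size bs by rewrite size_map.
have blt i : i < size bs -> nth 0 bs i < m by move=> h; apply: (disc_lt d); exact: mem_nth.
have blt' (i : 'I_(size (map f bs))) : nth 0 bs i < m.
  by apply: blt; rewrite -szE; exact: ltn_ord.
have m0 : 0 < m.
  have h : 0 < size bs by apply: leq_trans (dc_size d).
  exact: leq_ltn_trans (leq0n _) (blt _ h).
exists m, (triangles m L), (fun x => f x), (fun i => Ordinal (blt' i)).
have cyc (i : 'I_(size (map f bs))) :
    consecutive bs (nth 0 bs i) (nth 0 bs (ordS i)).
  left; apply/cycpairs_nth; exists i; first by rewrite -szE; exact: ltn_ord.
  by rewrite /= -szE.
split.
- exact: surface_complex.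
- split.
  + by rewrite szE; exact: dc_size d.
  + move=> i j [] /eqP; rewrite nth_uniq -?szE ?ltn_ord //; last exact: dc_uniq d.
    by move/eqP/val_inj.
  + by move=> i; apply/(is_bedgeP sL); apply/(dc_border d); exact: cyc.
  + move=> e he; have /andP [/andP [/cards2P [u [v [huv ee]]] _] _] := he.
    subst e; move/(is_bedgeP sL): he => /(dc_border d) h.
    have H (x y : 'I_m) : (nat_of_ord x, nat_of_ord y) \in cycpairs bs ->
       exists i : 'I_(size (map f bs)), [set x; y] =
         [set Ordinal (blt' i); Ordinal (blt' (ordS i))].
      case/cycpairs_nth => i hi [e1 e2]; rewrite -szE in hi.
      exists (Ordinal hi); congr [set _; _]; apply: val_inj => //=.
      by rewrite e2 szE.
    by case: h => [/H //|/H]; rewrite setUC.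
- move=> t ht x y hx hy hxy.
  by have [w [_ /un]] := triangle_third sL ht hx hy hxy.
- by move=> i; rewrite /= (nth_map 0) // -szE ltn_ord.
Qed.

(** * Words of unit vectors *)

Definition psub (p q : point) : point := padd p (pscale (-1) q).
Definition nrm (v : point) : R := pdot v v.

Ltac pcoords :=
  repeat match goal with p : point |- _ => destruct p as [[? ?] ?] end;
  rewrite ?/nrm ?/psub ?/dist2 ?/origin /padd /pscale /pdot /=.
Ltac pring := pcoords; first [ring | congr (_, _, _); ring].

Section Words.
Local Open Scope R_scope.
Implicit Types (p q u v a b : point) (w l t : seq point).

Lemma dist2E p q : dist2 p q = nrm (psub p q). Proof. by []. Qed.

Lemma paddA p u v : padd (padd p u) v = padd p (padd u v). Proof. by pring. Qed.
Lemma nrm_opp u : nrm (pscale (-1) u) = nrm u. Proof. by pring. Qed.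
Lemma nrm_subC u v : nrm (psub u v) = nrm (psub v u). Proof. by pring. Qed.

(** The end point is left out, so a closed word lists each corner of its closed curve once. *)
Fixpoint pts p w : seq point := if w is u :: w' then p :: pts (padd p u) w' else [::].
Definition endp p w := foldl padd p w.

Lemma pts_cat p w l : pts p (w ++ l) = pts p w ++ pts (endp p w) l.
Proof. by elim: w p => //= u w IH p; rewrite IH. Qed.
Lemma endp_cat p w l : endp p (w ++ l) = endp (endp p w) l.
Proof. exact: foldl_cat. Qed.
Lemma size_pts p w : size (pts p w) = size w.
Proof. by elim: w p => //= u w IH p; rewrite IH. Qed.

(* Elementary moves on unit-edge paths, recorded by their edge vectors: gluing
   two triangles along [u; v], or one triangle. *)
Inductive rw : seq point -> seq point -> Prop :=
| rw_flip u v u' v' : nrm u = 1 -> nrm v = 1 -> nrm u' = 1 -> nrm v' = 1 ->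
    nrm (psub u u') = 1 -> padd u v = padd u' v' -> rw [:: u; v] [:: u'; v']
| rw_cut u v : nrm u = 1 -> nrm v = 1 -> nrm (padd u v) = 1 -> rw [:: u; v] [:: padd u v]
| rw_refl w : rw w w
| rw_trans w l t : rw w l -> rw l t -> rw w t
| rw_ctx l t w w' : rw w w' -> rw (l ++ w ++ t) (l ++ w' ++ t).

Lemma rw_size w w' : rw w w' -> (size w' <= size w)%N.
Proof.
elim=> {w w'} [//|//|//|w l t _ h1 _ h2|l t w w' _ h].
  exact: leq_trans h2 h1.
by rewrite !size_cat leq_add2l leq_add2r.
Qed.

Lemma rw_endp w w' : rw w w' -> forall p, endp p w = endp p w'.
Proof.
elim=> {w w'} [u v u' v' _ _ _ _ _ e p|u v _ _ _ p|//|w l t _ h1 _ h2 p|l t w w' _ h p].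
- by rewrite /endp /= !paddA e.
- by rewrite /endp /= paddA.
- by rewrite h1 h2.
- by rewrite !endp_cat h.
Qed.

(** Exposes the vertex after [v] in cyclic order. If [t] is empty, it is the base point [p], which
    is listed first in [pts p l]. *)
Lemma closed_split p l t u v : (2 < size (l ++ [:: u; v] ++ t))%N ->
  endp p (l ++ [:: u; v] ++ t) = p ->
  exists g, pts (padd (padd (endp p l) u) v) t ++ pts p l =
    padd (padd (endp p l) u) v :: g.
Proof.
case: t => [|b t] sz.
  rewrite cats0 endp_cat /= => ->.
  by case: l sz => //= b l _; eexists.
by move=> _ /=; eexists.
Qed.

(** Moves never lengthen a word, so the size bound on the final curve covers all intermediate
    ones. *)
Lemma rw_patched w w' : rw w w' -> forall l t p, endp p (l ++ w ++ t) = p ->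
  (2 < size (l ++ w' ++ t))%N -> patched (pts p (l ++ w ++ t)) ->
  patched (pts p (l ++ w' ++ t)).
Proof.
elim=> {w w'} [u v u' v' n1 n2 n3 n4 n5 e|u v n1 n2 n3|//|w x y h1 IH1 h2 IH2|x y w w' _ IH]
   l t p cl sz.
- have sz' : (2 < size (l ++ [:: u; v] ++ t))%N by move: sz; rewrite !size_cat.
  have [g eg] := closed_split sz' cl.
  have e2 : padd (padd (endp p l) u') v' = padd (padd (endp p l) u) v by rewrite !paddA e.
  rewrite !pts_cat => /patched_cat; rewrite /= e2 eg => h.
  have {}h := @patched_flip _ _ (padd (endp p l) u') _ _ h.
  have -> : pts p l ++ [:: endp p l, padd (endp p l) u' &
      pts (padd (padd (endp p l) u) v) t] =
    pts p l ++ ([:: endp p l; padd (endp p l) u'] ++ pts (padd (padd (endp p l) u) v) t) by [].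
  apply: patched_cat; rewrite -catA eg; apply: h; rewrite dist2E.
  + by rewrite -n3; move: (endp p l) => q; clear; pring.
  + by rewrite -n5; move: (endp p l) => q; clear; pring.
  + by rewrite -e2 -n4; move: (endp p l) => q; clear; pring.
- have sz' : (2 < size (l ++ [:: u; v] ++ t))%N.
    by apply: leq_trans sz _; rewrite !size_cat leq_add2l leq_add2r.
  have [g eg] := closed_split sz' cl.
  rewrite !pts_cat => /patched_cat; rewrite /= -paddA eg => h.
  have -> : pts p l ++ endp p l :: pts (padd (padd (endp p l) u) v) t =
    pts p l ++ ([:: endp p l] ++ pts (padd (padd (endp p l) u) v) t) by [].
  apply: patched_cat; rewrite -catA eg; apply: (patched_notch h).
    have := congr1 size eg; rewrite size_cat !size_pts /=.
    by move: sz; rewrite !size_cat /=; case: (g) => //= ; lia.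
  by rewrite dist2E -n3; move: (endp p l) => q; clear; pring.
- move=> h; apply: IH2 => //.
    by rewrite !endp_cat -(rw_endp h1) -!endp_cat.
  apply: IH1 => //; apply: leq_trans sz _.
  by rewrite !size_cat leq_add2l leq_add2r; exact: rw_size.
- have e z : l ++ (x ++ z ++ y) ++ t = (l ++ x) ++ z ++ (y ++ t) by rewrite !catA.
  by rewrite !e in cl sz *; exact: IH.
Qed.

Lemma rw_cat w w' l l' : rw w w' -> rw l l' -> rw (w ++ l) (w' ++ l').
Proof.
move=> h1 h2; apply: (@rw_trans _ (w' ++ l)).
  exact: (@rw_ctx [::] l).
by have := @rw_ctx w' [::] _ _ h2; rewrite !cats0.
Qed.

Lemma rw_cons u w w' : rw w w' -> rw (u :: w) (u :: w').
Proof. exact: (@rw_cat [:: u] [:: u] w w' (rw_refl _)). Qed.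

Lemma rw_flatten (T : Type) (F G : T -> seq point) (s : seq T) :
  (forall k, rw (F k) (G k)) -> rw (flatten (map F s)) (flatten (map G s)).
Proof. by move=> h; elim: s => [|k s IH] /=; [exact: rw_refl | exact: rw_cat]. Qed.

(** * Moves on words with every vector repeated *)

Lemma rw_push a b m : rw [:: a; b] [:: b; a] ->
  rw (nseq m a ++ [:: b]) (b :: nseq m a).
Proof.
move=> h; elim: m => [|m IH] /=; first exact: rw_refl.
apply: (rw_trans (rw_cons a IH)).
exact: (@rw_cat [:: a; b] [:: b; a] _ _ h (rw_refl _)).
Qed.

Lemma rw_pull a b m : rw [:: b; a] [:: a; b] ->
  rw (b :: nseq m a) (nseq m a ++ [:: b]).
Proof.
move=> h; elim: m => [|m IH] /=; first exact: rw_refl.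
apply: (rw_trans _ (rw_cons a IH)).
exact: (@rw_cat [:: b; a] [:: a; b] _ _ h (rw_refl _)).
Qed.

Lemma nseqSr m a : nseq m.+1 a = nseq m a ++ [:: a].
Proof. by elim: m => //= m ->. Qed.

(** Flip the middle pair, then carry [u'] to the front and [v'] to the back, which leaves the case
    of [r] copies. The commutations are flips because [u - u'] and [v' - v] are the same unit
    vector. *)
Lemma rw_flip_blow r u v u' v' : nrm u = 1 -> nrm v = 1 -> nrm u' = 1 -> nrm v' = 1 ->
  nrm (psub u u') = 1 -> padd u v = padd u' v' ->
  rw (nseq r u ++ nseq r v) (nseq r u' ++ nseq r v').
Proof.
move=> n1 n2 n3 n4 n5 e.
have h1 : rw [:: u; u'] [:: u'; u] by apply: rw_flip => //; clear; pring.
have h2 : rw [:: v'; v] [:: v; v'].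
  apply: rw_flip => //; last by clear; pring.
  rewrite -n5; suff -> : psub v' v = psub u u' by [].
  by move: e; clear; pcoords; case=> *; congr (_, _, _); lra.
elim: r => [|r IH]; first exact: rw_refl.
rewrite (nseqSr r u) -catA.
apply: (@rw_trans _ (nseq r u ++ [:: u'; v'] ++ nseq r v)).
  by apply: rw_ctx (rw_flip _ _ _ _ _ _).
apply: (@rw_trans _ ((u' :: nseq r u) ++ (nseq r v ++ [:: v']))).
  rewrite (_ : nseq r u ++ _ = (nseq r u ++ [:: u']) ++ (v' :: nseq r v)).
    by apply: rw_cat; [exact: rw_push | exact: rw_pull].
  by rewrite -catA.
rewrite (nseqSr r v') /= catA; apply: rw_cons; rewrite [in X in rw _ X]catA.
by apply: rw_cat => //; exact: rw_refl.
Qed.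

(** Cut the middle pair and carry [padd u v] to the front past the copies of [u], a flip because the
    two differ by the unit vector [v]. *)
Lemma rw_cut_blow r u v : nrm u = 1 -> nrm v = 1 -> nrm (padd u v) = 1 ->
  rw (nseq r u ++ nseq r v) (nseq r (padd u v)).
Proof.
move=> n1 n2 n3.
have h1 : rw [:: u; padd u v] [:: padd u v; u].
  by apply: rw_flip => //; [rewrite -n2|]; clear; pring.
elim: r => [|r IH]; first exact: rw_refl.
rewrite (nseqSr r u) -catA.
apply: (@rw_trans _ (nseq r u ++ [:: padd u v] ++ nseq r v)).
  by apply: rw_ctx (rw_cut _ _ _).
rewrite catA; apply: (@rw_trans _ ((padd u v :: nseq r u) ++ nseq r v)).
  by apply: rw_cat (rw_refl _); exact: rw_push.
by rewrite /=; apply: rw_cons.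
Qed.

Definition blow (r : nat) w : seq point := flatten (map (nseq r) w).

Lemma blow_cat r w l : blow r (w ++ l) = blow r w ++ blow r l.
Proof. by rewrite /blow map_cat flatten_cat. Qed.

Lemma rw_blow r w w' : rw w w' -> rw (blow r w) (blow r w').
Proof.
elim=> {w w'} [u v u' v' n1 n2 n3 n4 n5 e|u v n1 n2 n3|w|w l t _ h1 _ h2|l t w w' _ h].
- by rewrite /blow /= !cats0; exact: rw_flip_blow.
- by rewrite /blow /= !cats0; exact: rw_cut_blow.
- exact: rw_refl.
- exact: rw_trans h1 h2.
- by rewrite !blow_cat; exact: rw_ctx.
Qed.

Lemma size_blow r w : size (blow r w) = (size w * r)%N.
Proof. by elim: w => //= u w IH; rewrite size_cat IH size_nseq mulSn. Qed.

Lemma endp_nseq p k u : endp p (nseq k u) = padd p (pscale (INR k) u).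
Proof.
elim: k p => [|k IH] p; first by rewrite /=; pring.
rewrite nseqSr endp_cat IH S_INR /=; move: (INR k) => x; by pring.
Qed.

Lemma endp_add p w : endp p w = padd p (endp origin w).
Proof.
elim: w p => [|u w IH] p /=; first by rewrite /=; pring.
by rewrite IH (IH (padd origin u)); move: (endp _ _) => q; pring.
Qed.

Lemma endp_blow p r w : endp p (blow r w) = padd p (pscale (INR r) (endp origin w)).
Proof.
elim: w p => [|u w IH] p /=; first by rewrite /=; pring.
rewrite /blow /= endp_cat -/(blow r w) IH endp_nseq (endp_add (padd origin u)).
by move: (endp _ _) => q; pring.
Qed.

Definition patched_word (r : nat) p w := patched (pts p (blow r w)).

Lemma patched_word_rw r p w w' : rw w w' -> endp origin w = origin ->
  (2 < size w' * r)%N -> patched_word r p w -> patched_word r p w'.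
Proof.
move=> h cl sz; have := rw_patched (rw_blow r h).
move=> /(_ [::] [::] p); rewrite !cats0 /=; apply; last by rewrite size_blow.
by rewrite endp_blow cl; pring.
Qed.

Lemma patched_word_rot r p w u : endp origin (rcons w u) = origin ->
  patched_word r p (rcons w u) -> patched_word r (psub p (pscale (INR r) u)) (u :: w).
Proof.
move=> cl; rewrite /patched_word -cats1 blow_cat pts_cat => /patched_cat.
have e : endp p (blow r w) = psub p (pscale (INR r) u).
  move: cl; rewrite endp_blow -cats1 endp_cat /=; move: (endp _ w) => q.
  by pcoords; case=> *; congr (_, _, _); nra.
rewrite e.
have e2 : p = endp (psub p (pscale (INR r) u)) (blow r [:: u]).
  by rewrite endp_blow /=; pring.
by move=> h; rewrite -[u :: w]cat1s blow_cat pts_cat -e2.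
Qed.

(** * Spikes and their degenerate domes *)

Lemma pts_spikes p u k : pts p (flatten (nseq k [:: u; pscale (-1) u])) =
  flatten (nseq k [:: p; padd p u]).
Proof.
elim: k => //= k IH.
by rewrite (_ : padd (padd p u) _ = p) ?IH //; pring.
Qed.

Lemma endp_spikes u k : endp origin (flatten (nseq k [:: u; pscale (-1) u])) = origin.
Proof.
elim: k => //= k IH; rewrite (_ : padd (padd origin u) _ = origin) //.
by clear; pring.
Qed.

Lemma pts_nseq p k u : pts p (nseq k u) = [seq padd p (pscale (INR j) u) | j <- iota 0 k].
Proof.
elim: k => [//|k IH]; rewrite nseqSr pts_cat IH endp_nseq -addn1 iotaD map_cat.
by [].
Qed.

Lemma nth_alternate (T : Type) (o x y : T) k i : (i < k.*2)%N ->
  nth o (flatten (nseq k [:: x; y])) i = if odd i then y else x.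
Proof. by elim: k i => // k IH [|[|i]] //= hi; rewrite IH // negbK. Qed.

Lemma size_alternate (T : Type) (x y : T) k : size (flatten (nseq k [:: x; y])) = k.*2.
Proof. by elim: k => //= k ->. Qed.

Lemma rw_spike_turn u v : nrm u = 1 -> nrm v = 1 -> nrm (psub u v) = 1 ->
  rw [:: u; pscale (-1) u] [:: v; pscale (-1) v].
Proof. by move=> h1 h2 h3; apply: rw_flip; rewrite ?nrm_opp //; pring. Qed.

(** The spike is turned through 180 degrees in three steps of 60, its direction passing through
    [-u], [v - u], [v], [u]. *)
Lemma rw_spike_swap u v : nrm u = 1 -> nrm v = 1 -> nrm (psub u v) = 1 ->
  rw [:: pscale (-1) u; u] [:: u; pscale (-1) u].
Proof.
move=> h1 h2 h3; have h4 : nrm (psub v u) = 1 by rewrite nrm_subC.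
have e : pscale (-1) (pscale (-1) u) = u by clear; pring.
rewrite -{2}e; apply: (rw_trans (@rw_spike_turn _ (psub v u) _ _ _)) => //.
- by rewrite nrm_opp.
- by rewrite -h2; clear; pring.
apply: (rw_trans (@rw_spike_turn _ v _ _ _)) => //.
  by rewrite -h1; clear; pring.
exact: rw_spike_turn.
Qed.

(** Merges [r] unit spikes into one spike of length [r], the form that repeating every vector
    produces. *)
Lemma rw_spikes_blow r u v : nrm u = 1 -> nrm v = 1 -> nrm (psub u v) = 1 ->
  rw (flatten (nseq r [:: u; pscale (-1) u])) (blow r [:: u; pscale (-1) u]).
Proof.
move=> h1 h2 h3; rewrite /blow /= cats0; elim: r => [|r IH] /=; first exact: rw_refl.
apply: rw_cons; apply: (rw_trans (rw_cons _ IH)).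
rewrite -cat1s catA -[pscale (-1) u :: nseq r _]cat1s [in X in rw _ X]catA.
apply: rw_cat (rw_refl _); apply: rw_pull; exact: rw_spike_swap h3.
Qed.

(** The starting surface is a wheel with hub at [padd p v] and rim alternating between [p] and
    [padd p u]; all its triangles map to a single unit triangle. *)
Lemma patched_word_spikes r n p u v : nrm u = 1 -> nrm v = 1 -> nrm (psub u v) = 1 ->
  (2 < n * r)%N ->
  patched_word r p (flatten (nseq n [:: u; pscale (-1) u])).
Proof.
move=> h1 h2 h3 sz.
have H : rw (flatten (nseq (n * r) [:: u; pscale (-1) u]))
   (blow r (flatten (nseq n [:: u; pscale (-1) u]))).
  elim: (n) => [|k IH]; first exact: rw_refl.
  rewrite mulSn nseqD flatten_cat.
  rewrite (_ : flatten (nseq k.+1 _) =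
    [:: u; pscale (-1) u] ++ flatten (nseq k [:: u; pscale (-1) u])) // blow_cat.
  by apply: rw_cat => //; exact: rw_spikes_blow h3.
have := rw_patched H => /(_ [::] [::] p); rewrite !cats0 /=; apply.
- by rewrite endp_add endp_spikes; clear; pring.
- rewrite size_blow; apply: leq_trans sz _; rewrite leq_mul2r size_alternate -addnn.
  by rewrite leq_addr orbT.
have dv : dist2 (padd p v) p = 1 by rewrite dist2E -h2; clear; pring.
have dvu : dist2 (padd p v) (padd p u) = 1 by rewrite dist2E -h3; clear; pring.
have du : dist2 p (padd p u) = 1 by rewrite dist2E -h1; clear; pring.
rewrite pts_spikes.
have sz2 : (2 < (n * r).*2)%N by rewrite -addnn; apply: leq_trans sz (leq_addr _ _).
apply: (@patched_wheel (padd p v)); rewrite ?size_alternate //.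
- by move=> i hi; rewrite nth_alternate //; case: (odd i).
- move=> i hi; rewrite !nth_alternate ?(ltnW hi) //=; case: (odd i) => //=.
  by rewrite dist2_sym.
- have dbl0 : (0 < (n * r).*2)%N by apply: ltnW; apply: ltnW.
  rewrite -nth_last -nth0 size_alternate !nth_alternate ?prednK //=.
  rewrite (_ : odd _ = true); first by rewrite dist2_sym.
  by case: (n * r)%N dbl0 => //= k _; rewrite odd_double.
Qed.
End Words.

(** * Crowns of a regular polygon *)

Section Frame.
Local Open Scope R_scope.

Definition pcross (p q : point) : point :=
  let '(x1, y1, z1) := p in let '(x2, y2, z2) := q in
  (y1 * z2 - z1 * y2, z1 * x2 - x1 * z2, x1 * y2 - y1 * x2).

Definition in_frame (e1 e2 : point) (a b h : R) : point :=
  padd (padd (pscale a e1) (pscale b e2)) (pscale h (pcross e1 e2)).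

Lemma nrm_in_frame e1 e2 a b h : orthonormal e1 e2 ->
  nrm (in_frame e1 e2 a b h) = a ^ 2 + b ^ 2 + h ^ 2.
Proof.
case=> h1 [h2 h3].
have -> : nrm (in_frame e1 e2 a b h) = a ^ 2 * pdot e1 e1 + b ^ 2 * pdot e2 e2 +
    2 * a * b * pdot e1 e2 + h ^ 2 * (pdot e1 e1 * pdot e2 e2 - pdot e1 e2 ^ 2).
  by clear; rewrite /in_frame /pcross; pring.
by rewrite h1 h2 h3; ring.
Qed.

Definition in_cyl e1 e2 (x al z : R) := in_frame e1 e2 (x * cos al) (x * sin al) z.

Lemma dist_in_cyl e1 e2 x al z x' al' z' : orthonormal e1 e2 ->
  nrm (psub (in_cyl e1 e2 x al z) (in_cyl e1 e2 x' al' z')) =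
  x ^ 2 + x' ^ 2 - 2 * x * x' * cos (al - al') + (z - z') ^ 2.
Proof.
move=> on.
have -> : psub (in_cyl e1 e2 x al z) (in_cyl e1 e2 x' al' z') =
    in_frame e1 e2 (x * cos al - x' * cos al') (x * sin al - x' * sin al') (z - z').
  by clear; rewrite /in_cyl /in_frame /pcross; pring.
rewrite nrm_in_frame // cos_minus.
have h1 := sin2_cos2 al; have h2 := sin2_cos2 al'; rewrite /Rsqr in h1 h2.
rewrite (_ : x ^ 2 = x ^ 2 * (sin al * sin al + cos al * cos al)); last by rewrite h1; ring.
rewrite (_ : x' ^ 2 = x' ^ 2 * (sin al' * sin al' + cos al' * cos al'));
  last by rewrite h2; ring.
ring.
Qed.
End Frame.

Lemma flatten_shift (T : Type) (f g : nat -> T) n :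
  f 0 :: flatten [seq [:: g k; f k.+1] | k <- iota 0 n] =
  rcons (flatten [seq [:: f k; g k] | k <- iota 0 n]) (f n).
Proof.
elim: n => [//|n IH].
have -> : iota 0 n.+1 = rcons (iota 0 n) n by rewrite -cats1 -(iotaD 0 n 1) addn1.
by rewrite !map_rcons !flatten_rcons -!cat_cons IH -!cats1 -!catA.
Qed.

Lemma size_flatten2 (T : Type) (f g : nat -> T) s :
  size (flatten [seq [:: f k; g k] | k <- s]) = (size s).*2.
Proof. by elim: s => //= k s ->. Qed.

(** * Zigzags between consecutive rows *)

Section Crowns.
Local Open Scope R_scope.
Variables (n r S : nat) (x z : nat -> R) (c e1 e2 : point) (th : R).
Hypothesis n3 : (2 < n)%N.
Hypothesis r0 : (0 < r)%N.
Hypothesis on : orthonormal e1 e2.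
Let sn := sin (PI / INR n).
Let cn := cos (PI / INR n).
Hypothesis S0 : (0 < S)%N.
Hypothesis x0 : x 0%N = / (2 * sn).
Hypothesis z0 : z 0%N = 0.
Hypothesis xS : x S = 0.
Hypothesis side : forall i, (i < S)%N -> unit_cross cn (x i) (z i) (x i.+1) (z i.+1).
Hypothesis rung : forall i, (i.+2 <= S)%N ->
  (x i.+2 - x i) ^ 2 + (z i.+2 - z i) ^ 2 = 1.
Hypothesis sn0 : 0 < sn.

Definition angle (j : nat) := th + INR j * (PI / INR n).
Definition pt (i j : nat) := in_cyl e1 e2 (x i) (angle j) (z i).
Definition vec (i j i' j' : nat) := psub (pt i' j') (pt i j).

Lemma angleS j : angle j.+1 = angle j + PI / INR n.
Proof. by rewrite /angle S_INR; ring. Qed.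

Lemma n_neq0 : INR n <> 0.
Proof. by apply: not_0_INR => e; move: n3; rewrite e. Qed.

Lemma pt_period i j : pt i (j + n.*2) = pt i j.
Proof.
have e : angle (j + n.*2) = angle j + 2 * INR 1 * PI.
  by rewrite /angle -addnn !plus_INR /=; field; exact: n_neq0.
by rewrite /pt /in_cyl e cos_period sin_period.
Qed.

Lemma nrm_up i j : (i < S)%N -> nrm (vec i j i.+1 j.+1) = 1.
Proof.
move=> hi; rewrite /vec /pt dist_in_cyl // angleS.
rewrite (_ : angle j + _ - _ = PI / INR n); last by ring.
by have := side hi; rewrite /unit_cross -/cn; lra.
Qed.

Lemma nrm_down i j : (i < S)%N -> nrm (vec i.+1 j i j.+1) = 1.
Proof.
move=> hi; rewrite /vec /pt dist_in_cyl // angleS.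
rewrite (_ : angle j + _ - _ = PI / INR n); last by ring.
by have := side hi; rewrite /unit_cross -/cn; lra.
Qed.

Lemma nrm_rung i j : (i.+2 <= S)%N -> nrm (psub (pt i.+2 j) (pt i j)) = 1.
Proof.
move=> hi; rewrite /pt dist_in_cyl // Rminus_diag cos_0.
by have := rung hi; lra.
Qed.

Lemma nrm_edge j : nrm (vec 0 j 0 j.+2) = 1.
Proof.
rewrite /vec /pt dist_in_cyl // !angleS x0 z0.
rewrite (_ : angle j + PI / INR n + PI / INR n - angle j = 2 * (PI / INR n)); last by ring.
rewrite cos_2a_sin -/sn; field; lra.
Qed.

Lemma nrm_vec_sym i j i' j' : nrm (vec i j i' j') = nrm (vec i' j' i j).
Proof. exact: nrm_subC. Qed.

(** Row [i] only uses columns with the parity of [i], columns being [PI / n] apart. [crown' i] is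
    the same closed zigzag begun one edge later, in row [i + 1]. *)
Definition crown i := flatten [seq [:: vec i (i + k.*2) i.+1 (i + k.*2).+1;
  vec i.+1 (i + k.*2).+1 i (i + k.*2).+2] | k <- iota 0 n].
Definition crown' i := flatten [seq [:: vec i.+1 (i + k.*2).+1 i (i + k.*2).+2;
  vec i (i + k.+1.*2) i.+1 (i + k.+1.*2).+1] | k <- iota 0 n].
Definition start i := padd c (pscale (INR r) (pt i i)).

Lemma vec_add i j i' j' i'' j'' : padd (vec i j i' j') (vec i' j' i'' j'') = vec i j i'' j''.
Proof. by rewrite /vec; move: (pt i j) (pt i' j') (pt i'' j'') => p q t; clear; pring. Qed.

Lemma crown'_closed i m : endp origin (flatten [seq [:: vec i.+1 (i + k.*2).+1 i (i + k.*2).+2;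
  vec i (i + k.+1.*2) i.+1 (i + k.+1.*2).+1] | k <- iota 0 m]) =
  vec i.+1 i.+1 i.+1 (i + m.*2).+1.
Proof.
elim: m => [|m IH].
  by rewrite /= addn0 /vec; move: (pt _ _) => p; clear; pring.
have -> : iota 0 m.+1 = rcons (iota 0 m) m by rewrite -cats1 -(iotaD 0 m 1) addn1.
rewrite map_rcons flatten_rcons endp_cat IH /= doubleS !addnS.
by rewrite !vec_add.
Qed.

Lemma crown_closed i m : endp origin (flatten [seq [:: vec i (i + k.*2) i.+1 (i + k.*2).+1;
  vec i.+1 (i + k.*2).+1 i (i + k.*2).+2] | k <- iota 0 m]) = vec i i i (i + m.*2).
Proof.
elim: m => [|m IH].
  by rewrite /= addn0 /vec; move: (pt _ _) => p; clear; pring.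
have -> : iota 0 m.+1 = rcons (iota 0 m) m by rewrite -cats1 -(iotaD 0 m 1) addn1.
rewrite map_rcons flatten_rcons endp_cat IH /= doubleS !addnS.
by rewrite !vec_add.
Qed.

Lemma vec_period i j : vec i j i (j + n.*2) = origin.
Proof. by rewrite /vec pt_period; move: (pt i j) => p; clear; pring. Qed.

Lemma patched_rotate i : patched_word r (start i.+1) (crown' i) -> patched_word r (start i) (crown i).
Proof.
have E := flatten_shift (fun k => vec i (i + k.*2) i.+1 (i + k.*2).+1)
  (fun k => vec i.+1 (i + k.*2).+1 i (i + k.*2).+2) n.
have F : vec i (i + n.*2) i.+1 (i + n.*2).+1 = vec i i i.+1 i.+1.
  by rewrite /vec -addSn !pt_period.
have G : rcons (crown i) (vec i i i.+1 i.+1) = vec i i i.+1 i.+1 :: crown' i.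
  rewrite /crown /crown' -{1}F; rewrite -[LHS]E.
  by congr (_ :: _); rewrite /vec /= ?addn0.
have cl : endp origin (crown i) = origin by rewrite crown_closed vec_period.
have [w ew] : exists w, crown i = vec i i i.+1 i.+1 :: w.
  by rewrite /crown -(prednK (ltnW (ltnW n3))) /= addn0; eexists.
have ew' : crown' i = rcons w (vec i i i.+1 i.+1).
  by move: G; rewrite ew rcons_cons => -[<-].
rewrite ew ew' => h.
have cl' : endp origin (rcons w (vec i i i.+1 i.+1)) = origin.
  rewrite -ew' /crown' crown'_closed -addSn vec_period //.
have := patched_word_rot cl' h.
suff -> : psub (start i.+1) (pscale (INR r) (vec i i i.+1 i.+1)) = start i by [].
by rewrite /start /vec; move: c (pt i i) (pt i.+1 i.+1) (INR r) => o p q t; clear; pring.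
Qed.

Lemma word_size : (2 < n * r)%N.
Proof. by apply: leq_trans n3 _; rewrite leq_pmulr. Qed.

(** Each point of row [i + 2] is flipped to the point of row [i] in the same column, at distance 1
    by [rung]. *)
Lemma patched_crown_flip i : (i.+2 <= S)%N ->
  patched_word r (start i.+1) (crown i.+1) -> patched_word r (start i.+1) (crown' i).
Proof.
move=> hi; apply: patched_word_rw.
- apply: rw_flatten => k; rewrite doubleS !addnS addSn.
  apply: rw_flip.
  + exact: nrm_up.
  + exact: nrm_down.
  + by apply: nrm_down; exact: ltnW.
  + by apply: nrm_up; exact: ltnW.
  + rewrite -(nrm_rung (i + k.*2).+2 hi); congr nrm; rewrite /vec.
    by move: (pt _ _) (pt _ _) (pt _ _) => p q t; clear; pring.
  + by rewrite !vec_add.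
- by rewrite crown_closed vec_period.
- rewrite size_flatten2 size_iota; apply: leq_trans word_size _.
  by rewrite leq_mul2r -addnn leq_addr orbT.
Qed.

Lemma patched_crown i : (i < S)%N ->
  patched_word r (start S) (crown' S.-1) -> patched_word r (start i) (crown i).
Proof.
(* Descending induction on the row: the count [S - i] starts at 1, the zigzag through the apex. *)
move=> hi h; rewrite -[i](subKn (ltnW hi)).
have : (0 < S - i)%N by rewrite subn_gt0.
have : (S - i <= S)%N by exact: leq_subr.
elim: (S - i)%N => [//|k IH] hk _.
case: k IH hk => [|k] IH hk.
  by rewrite subn1; apply: patched_rotate; rewrite prednK.
apply: patched_rotate; apply: patched_crown_flip.
  by rewrite subnSK // ltn_subrL.
by rewrite subnSK //; apply: IH => //; exact: ltnW.
Qed.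

Lemma iota0S m : iota 0 m.+1 = iota 0 m ++ [:: m].
Proof. by rewrite -addn1 iotaD. Qed.

Lemma apex_const j j' : pt S j = pt S j'.
Proof. by rewrite /pt /in_cyl xS !Rmult_0_l. Qed.

Definition spike k := vec S 0 S.-1 (S.-1 + k.*2).

Lemma nrm_spike k : nrm (spike k) = 1.
Proof.
rewrite -(@nrm_up S.-1 (S.-1 + k.*2)) ?prednK // nrm_vec_sym /spike /vec.
by rewrite (apex_const 0 (S.-1 + k.*2).+1).
Qed.

(** Neighbouring spikes at the apex are two 60 degree turns apart, via the point of row [S - 2] in
    the column between them; for [S = 1] they end at adjacent corners and one turn is enough. The
    vector [v] supplies the third corner of a degenerate dome. *)
Lemma spike_next k : exists2 v, nrm v = 1 /\ nrm (psub (spike k) v) = 1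
  & rw [:: spike k; pscale (-1) (spike k)] [:: spike k.+1; pscale (-1) (spike k.+1)].
Proof.
have n1 := nrm_spike k; have n2 := nrm_spike k.+1.
case: (leqP 2 S) => hS; last first.
  have S1 : S = 1%N by apply/eqP; rewrite eqn_leq S0 andbT.
  have h : nrm (psub (spike k) (spike k.+1)) = 1.
    rewrite -(nrm_edge k.*2) nrm_vec_sym; congr nrm.
    rewrite /spike /vec S1 /= add0n doubleS.
    by move: (pt _ _) (pt _ _) (pt _ _) => p q t; clear; pring.
  by exists (spike k.+1) => //; exact: rw_spike_turn.
pose j := (S.-1 + k.*2)%N; pose v := vec S 0 S.-2 j.+1.
have e : S.-2.+1 = S.-1 by rewrite prednK // -ltnS prednK.
have e' : S.-2.+2 = S by rewrite e prednK.
have hS' : (S.-2.+2 <= S)%N by rewrite e'.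
have nv : nrm v = 1.
  have := nrm_rung j.+1 hS'; rewrite e' => <-.
  by rewrite nrm_subC /v /vec (apex_const 0 j.+1).
have h1 : nrm (psub (spike k) v) = 1.
  rewrite -(@nrm_down S.-2 j) ?(ltnW hS') // e nrm_vec_sym; congr nrm.
  rewrite /spike /v /vec -/j.
  by move: (pt _ _) (pt _ _) (pt _ _) => p q t; clear; pring.
have h2 : nrm (psub v (spike k.+1)) = 1.
  rewrite -(@nrm_up S.-2 j.+1) ?(ltnW hS') // e nrm_vec_sym; congr nrm.
  rewrite /spike /v /vec doubleS !addnS -/j.
  by move: (pt _ _) (pt _ _) (pt _ _) => p q t; clear; pring.
exists v => //; apply: (rw_trans (rw_spike_turn n1 nv h1)).
exact: rw_spike_turn.
Qed.

Lemma crown'_spikes : crown' S.-1 =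
  flatten [seq [:: spike k.+1; pscale (-1) (spike k.+1)] | k <- iota 0 n].
Proof.
congr flatten; apply: eq_map => k; rewrite prednK // /spike doubleS !addnS.
congr [:: _; _]; rewrite /vec.
  by rewrite (apex_const _ 0).
rewrite (apex_const _ 0).
by move: (pt _ _) (pt _ _) => p q; clear; pring.
Qed.

(** Starts from [n] copies of [spike 1] and turns the copy of index [k] through [k] successive
    neighbours. *)
Lemma patched_star : patched_word r (start S) (crown' S.-1).
Proof.
have [v [nv hv] _] := spike_next 1.
have := patched_word_spikes (start S) (nrm_spike 1) nv hv word_size.
apply: patched_word_rw; last first.
- rewrite crown'_spikes size_flatten2 size_iota; apply: leq_trans word_size _.
  by rewrite leq_mul2r -addnn leq_addr orbT.
- exact: endp_spikes.
have -> : nseq n [:: spike 1; pscale (-1) (spike 1)] =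
    [seq [:: spike 1; pscale (-1) (spike 1)] | _ <- iota 0 n].
  by move: [:: spike 1; _] => X; elim: (n) 0%N => //= m IH a; rewrite -IH.
rewrite crown'_spikes; apply: rw_flatten => k.
elim: k => [|k IH]; first exact: rw_refl.
apply: (rw_trans IH); by have [] := spike_next k.+1.
Qed.

Definition sides m := [seq vec 0 k.*2 0 k.*2.+2 | k <- iota 0 m].

Lemma patched_sides : patched_word r (start 0) (sides n).
Proof.
have := patched_crown S0 patched_star; apply: patched_word_rw.
- rewrite /sides -flatten_map1; apply: rw_flatten => k; rewrite add0n.
  rewrite -(vec_add 0 k.*2 1 k.*2.+1 0 k.*2.+2); apply: rw_cut.
  + exact: nrm_up.
  + exact: nrm_down.
  + by rewrite vec_add; exact: nrm_edge.
- by rewrite crown_closed vec_period.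
- by rewrite size_map size_iota; exact: word_size.
Qed.

(** Corners are [2 * PI / n] apart, hence the even columns of row 0. *)
Lemma cornerE k : corner n r c e1 e2 th k = padd c (pscale (INR r) (pt 0 k.*2)).
Proof.
rewrite /corner /pt /in_cyl /in_frame x0 z0 /Rdiv -/(Rdiv PI (INR n)) -/sn.
have -> : angle k.*2 = th + 2 * PI * INR k * / INR n.
  by rewrite /angle -addnn plus_INR; field; exact: n_neq0.
move: (th + _) (/ (2 * sn)) (INR r) c e1 e2 => a b t p q q'; clear; rewrite /pcross.
by pring.
Qed.

Lemma pts_sides m : pts (start 0) (blow r (sides m)) =
  [seq subdiv_vertex n r c e1 e2 th i | i <- iota 0 (m * r)].
Proof.
have r_neq0 : INR r <> 0 by apply: not_0_INR => e; move: r0; rewrite e.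
have E k : endp (start 0) (blow r (sides k)) = padd c (pscale (INR r) (pt 0 k.*2)).
  elim: k => [|k IH] //.
  rewrite /sides iota0S map_cat blow_cat endp_cat IH /blow /= cats0 endp_nseq /vec doubleS.
  by move: c (pt _ _) (pt _ _) (INR r) => o p q t; clear; pring.
elim: m => [|m IH] //.
rewrite /sides iota0S map_cat blow_cat pts_cat E IH mulSn addnC iotaD add0n map_cat.
congr (_ ++ _); rewrite /blow /= cats0 pts_nseq -[(m * r)%N]addn0 iotaDl -map_comp.
apply/eq_in_map => j; rewrite mem_iota add0n => /andP [_ hj].
rewrite /= /subdiv_vertex divnMDl // divn_small // addn0 modnMDl modn_small //.
rewrite !cornerE doubleS /vec.
have : INR j = INR j / INR r * INR r by field.
move: (INR j / INR r) => t' ->.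
by move: c (pt _ _) (pt _ _) (INR r) => o p q t; clear; pring.
Qed.

Lemma crowns_domed : can_be_domed (regular_polygon n r c e1 e2 th).
Proof.
by apply: patched_domed; rewrite /regular_polygon -pts_sides; exact: patched_sides.
Qed.
End Crowns.

(** * The half central angle and the conclusion *)

Section Polygon.
Local Open Scope R_scope.

Lemma polygon_angle n : (2 < n)%N -> [/\ 0 < sin (PI / INR n), 0 < cos (PI / INR n)
  & sin (PI / INR n) ^ 2 + cos (PI / INR n) ^ 2 = 1].
Proof.
move=> n3; have hn : INR 3 <= INR n by apply: le_INR; apply/leP.
rewrite /= in hn; have PI0 := PI_RGT_0.
have a0 : 0 < PI / INR n by apply: Rdiv_lt_0_compat; lra.
have a1 : PI / INR n < PI / 2.
  by apply: Rmult_lt_compat_l => //; apply: Rinv_lt_contravar; lra.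
split; [by apply: sin_gt_0; lra | by apply: cos_gt_0; lra |].
by have := sin2_cos2 (PI / INR n); rewrite /Rsqr; lra.
Qed.
End Polygon.

Theorem theorem1p3 :
  forall (n r : nat), 3 <= n -> 0 < r ->
  forall (c e1 e2 : point) (th : R), orthonormal e1 e2 ->
  can_be_domed (regular_polygon n r c e1 e2 th).
Proof.
move=> n r n3 r0 c e1 e2 th on; have [s0 c0 sc1] := polygon_angle n3.
have [S [x [z [S0 [x0 z0] xS side rung]]]] := profile_exists s0 c0 sc1.
exact: (crowns_domed c th n3 r0 on S0 x0 z0 xS side rung s0).
Qed.
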